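(* Let $K$ be a scattered compact space of uncountable weight and let $\mu=\sum_{i\in I}r_i\delta_{x_i}\in P(K)$, where $x_i\in K$ are pairwise distinct and $r_i>0$ for $i\in I$. Then $$\mathbb{O}_\mu(P(K))\cong\prod_{i\in I}\mathbb{O}_{\delta_{x_i}}(P(K)).$$ That is, there is a cofinal $\sigma$-semilattice $\mathcal{S}\subset\mathcal{Q}_\omega(P(K))$ such that for all $L<L'$ in $\mathcal{S}$ with natural projection $q:L'\to L$, the ordered sets $\mathbb{O}_{p_L(\mu)}(q)$ and $\prod_{i\in I}\mathbb{O}_{p_L(\delta_{x_i})}(q)$ are order-isomorphic.
   Context: All compact spaces are Hausdorff. $P(K)$ is the space of Radon probability measures on $K$ with the weak$^*$ topology; $\delta_x$ is the Dirac measure at $x$. (The index set $I$ is necessarily countable.) Products of ordered sets carry the coordinatewise order. Fiber orders: for a continuous map $f:X\to Y$ and $y\in Y$, the fiber $\mathbb{F}_y(f)=f^{-1}(y)$ is preordered by: $s\leq t$ iff for every neighborhood $U$ of $s$ there is a neighborhood $V$ of $t$ with $f(V)\subset f(U)$. $\mathbb{O}_y(f)=\mathbb{F}_y(f)/\sim$ is the associated ordered set, where $s\sim t$ iff $s\leq t$ and $t\leq s$. For a compact space $X$ of uncountable weight, $\mathcal{Q}_\omega(X)$ is the set of all Hausdorff quotient spaces $L$ of $X$ of countable weight, with canonical projections $p_L:X\to L$ (a quotient is identified with its equivalence relation on $X$), ordered by: $L\leq L'$ iff there is a continuous surjection $q:L'\to L$ (called the natural projection) with $q\,p_{L'}=p_L$.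 Countable subsets of $\mathcal{Q}_\omega(X)$ have suprema in $\mathcal{Q}_\omega(X)$ (the supremum corresponds to the intersection of the equivalence relations). A set $\mathcal{S}\subset\mathcal{Q}_\omega(X)$ is cofinal if every $L\in\mathcal{Q}_\omega(X)$ satisfies $L\leq L'$ for some $L'\in\mathcal{S}$; it is a $\sigma$-semilattice if the supremum of every countable subset of $\mathcal{S}$ belongs to $\mathcal{S}$. *)

(* Defs.v *)
From HB Require Import structures.
From mathcomp Require Export all_boot all_order all_algebra generic_quotient.
From mathcomp Require Export all_classical all_reals all_analysis.
Export numFieldNormedType.Exports.

Set Implicit Arguments.
Unset Strict Implicit.
Unset Printing Implicit Defensive.

Import Order.TTheory GRing.Theory Num.Theory.

Local Open Scope classical_set_scope.
Local Open Scope ring_scope.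
Local Open Scope quotient_scope.

Definition scattered (X : topologicalType) :=
  forall A : set X, A !=set0 -> isolated A !=set0.

(* [ptopologicalType] only because [measurableType]s are pointed. *)
Definition borel (K : ptopologicalType) := g_sigma_algebraType (@open K).

Section radon_prob.
Context (K : ptopologicalType) (R : realType).

(* Inner regularity with respect to compact sets; K is meant to be Hausdorff,
   so that compact sets are Borel.  A library measure is a function defined on
   all subsets, whose values on non-Borel sets are arbitrary.  Stating the
   condition for all subsets A, not only the Borel ones, forces the value on a
   non-Borel set to be the inner measure, so that every Radon probability is
   represented exactly once (lemmas [radon_prob_eq] and [radon_prob_exists]). *)
Definition radon (mu : set K -> \bar R) := forall A : set K,
  mu A = ereal_sup [set mu C | C in [set C | compact C /\ C `<=` A]].

Record radon_prob := RadonProb {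
  radon_measure :> probability (borel K) R;
  radon_measureP : radon radon_measure }.

HB.instance Definition _ := gen_eqMixin radon_prob.
HB.instance Definition _ := gen_choiceMixin radon_prob.

Definition radon_eval (mu : radon_prob) : {ptws continuousType K R -> R} :=
  fun f => \int[mu]_(x in [set: borel K]) f x.

HB.instance Definition _ :=
  Topological.copy radon_prob (initial_topology radon_eval).

Lemma radon_dirac (x : K) : radon (@dirac _ (borel K) x R).
Proof.
move=> A; apply/eqP; rewrite eq_le; apply/andP; split.
  rewrite /dirac indicE; case: (boolP (x \in A)) => xA; last first.
    apply: ereal_sup_ubound; exists set0; first by split; [exact: compact0|].
    by rewrite indicE in_set0.
  apply: ereal_sup_ubound; exists [set x]; last by rewrite indicE mem_set.
  by split; [exact: compact_set1 | move=> _ ->; exact: set_mem].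
apply: ge_ereal_sup => _ [C [_ CA] <-]; rewrite /dirac !indicE lee_fin ler_nat.
by case: (boolP (x \in C)) => // /set_mem /CA /mem_set ->.
Qed.

Definition dirac_prob (x : K) : radon_prob :=
  RadonProb (radon_dirac x : radon (@dirac _ (borel K) x R : probability _ _)).

Lemma compact_borel : hausdorff_space K ->
  forall C : set K, compact C -> measurable (C : set (borel K)).
Proof.
move=> hK C /(compact_closed hK) cC.
rewrite -[C]setCK; apply: (@measurableC _ (borel K)).
by apply: sub_sigma_algebra; exact: closed_openC.
Qed.

Lemma radon_prob_eq : hausdorff_space K -> forall mu nu : radon_prob,
  (forall A : set (borel K), measurable A -> mu A = nu A) -> mu = nu.
Proof.
move=> hK [mu rmu] [nu rnu] /= munu.
have E : mu = nu :> (set (borel K) -> \bar R).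
  apply/funext => A; rewrite rmu rnu; congr ereal_sup.
  by apply/seteqP; split => _ [C [cC CA] <-]; exists C => //;
    rewrite munu//; exact: compact_borel.
have {}munu : mu = nu.
  case: mu nu E {rmu rnu munu} => [m [[m1 m2] [m3] [m4] [m5] [m6] [m7] [m8]]].
  case=> [n [[n1 n2] [n3] [n4] [n5] [n6] [n7] [n8]]] /= mn; subst n.
  rewrite (Prop_irrelevance n1 m1) (Prop_irrelevance n2 m2).
  rewrite (Prop_irrelevance n3 m3) (Prop_irrelevance n4 m4).
  rewrite (Prop_irrelevance n5 m5) (Prop_irrelevance n6 m6).
  by rewrite (Prop_irrelevance n7 m7) (Prop_irrelevance n8 m8).
by subst nu; congr RadonProb; exact: Prop_irrelevance.
Qed.

Lemma radon_prob_exists : hausdorff_space K ->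
  forall P : probability (borel K) R,
  (forall A : set (borel K), measurable A ->
    P A = ereal_sup [set P C | C in [set C : set K | compact C /\ C `<=` A]]) ->
  exists mu : radon_prob, forall A : set (borel K), measurable A -> mu A = P A.
Proof.
move=> hK P rP.
pose m (A : set (borel K)) :=
  ereal_sup [set P C | C in [set C : set K | compact C /\ C `<=` A]].
have mP (A : set (borel K)) : measurable A -> m A = P A by move=> mA; rewrite [RHS]rP.
have m0 : m set0 = 0%E by rewrite mP ?measure0//; exact: measurable0.
have m_ge0 A : (0 <= m A)%E.
  apply: ereal_sup_ubound; exists set0; last by rewrite measure0.
  by split; [exact: compact0|].
have m_sigma : semi_sigma_additive m.
  move=> F mF tF mUF; rewrite mP// (_ : (fun n => _) =
    (fun n => \sum_(0 <= i < n) P (F i))%E); last first.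
    by apply/funext => n; apply: eq_bigr => i _; rewrite mP.
  exact: measure_semi_sigma_additive.
pose mM := isMeasure.Build _ _ _ m m0 m_ge0 m_sigma.
pose mm : {measure set (borel K) -> \bar R} := HB.pack m mM.
have m1 : mm setT = 1%E by rewrite [mm _]mP ?probability_setT//; exact: measurableT.
pose pM := Measure_isProbability.Build _ _ _ mm m1.
pose pm : probability (borel K) R := HB.pack m mM pM.
have rpm : radon pm.
  move=> A; rewrite [pm A]/(m A) /m; congr ereal_sup.
  by apply/seteqP; split => _ [C [cC CA] <-]; exists C => //;
    rewrite [pm C]mP//; exact: compact_borel.
by exists (RadonProb rpm) => A mA; exact: mP.
Qed.

End radon_prob.
Section quotients.
Context (X : topologicalType).
Implicit Types (L M : equiv_rel X) (A S : set (equiv_rel X)).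

Definition quot L : topologicalType := quotient_topology {eq_quot L}.

Definition quot_proj L (x : X) : quot L := \pi_(quot L) x.

Definition Qomega : set (equiv_rel X) :=
  [set L | hausdorff_space (quot L) /\ @second_countable (quot L)].

Definition natural_projection L L' (q : quot L' -> quot L) :=
  [/\ continuous q, (forall z, exists z', q z' = z) &
      forall x, q (quot_proj L' x) = quot_proj L x].

Definition quot_le L L' :=
  exists q : quot L' -> quot L, natural_projection q.

Definition quot_lt L L' := quot_le L L' /\ ~ quot_le L' L.

Definition cofinal S := forall L, Qomega L -> exists2 L', S L' & quot_le L L'.

Definition is_supremum A M :=
  [/\ Qomega M, (forall L, A L -> quot_le L M) &
      forall M', Qomega M' -> (forall L, A L -> quot_le L M') -> quot_le M M'].

Definition sigma_semilattice S :=
  forall A, A `<=` S -> countable A -> exists2 M, S M & is_supremum A M.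

Lemma quot_projE L x y : (quot_proj L x = quot_proj L y) <-> L x y.
Proof.
rewrite /quot_proj; split=> [/(congr1 (fun z : quot L => z : {eq_quot L}))|Lxy].
  by move=> e; apply/(@eqmodP _ L).
exact: (@eqmodP _ L _ _ Lxy).
Qed.

Lemma quot_leP L L' : quot_le L L' <-> (forall x y, L' x y -> L x y).
Proof.
split=> [[q [_ _ qE]] x y /quot_projE L'xy|LL'].
  by apply/quot_projE; rewrite -!qE L'xy.
have qE x : quot_proj L (repr (quot_proj L' x)) = quot_proj L x.
  by apply/quot_projE/LL'/quot_projE; rewrite {1}/quot_proj reprK.
exists (fun z => quot_proj L (repr z)); split => //.
  apply/quotient_continuous.
  rewrite (_ : _ \o _ = quot_proj L); last by apply/funext => x; exact: qE.
  exact: pi_continuous.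
by move=> z; exists (quot_proj L' (repr z)); rewrite qE /quot_proj reprK.
Qed.

End quotients.

Section fiber_order.
Context (X Y : topologicalType) (f : X -> Y).

Definition fiber_le (s t : X) :=
  forall U, nbhs s U -> exists2 V, nbhs t V & f @` V `<=` f @` U.

Lemma fiber_le_refl s : fiber_le s s.
Proof. by move=> U sU; exists U. Qed.

Lemma fiber_le_trans t s u : fiber_le s t -> fiber_le t u -> fiber_le s u.
Proof.
move=> st tu U /st[V /tu[W uW WV] VU].
by exists W => //; exact: subset_trans VU.
Qed.

Context (y : Y).

Definition fiber := set_type (f @^-1` [set y]).

Definition fiber_equiv (s t : fiber) :=
  `[< fiber_le (val s) (val t) /\ fiber_le (val t) (val s) >].

Lemma fiber_equiv_refl : reflexive fiber_equiv.
Proof. by move=> s; apply/asboolP; split; exact: fiber_le_refl. Qed.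

Lemma fiber_equiv_sym : symmetric fiber_equiv.
Proof. by move=> s t; apply/asboolP/asboolP => -[]. Qed.

Lemma fiber_equiv_trans : transitive fiber_equiv.
Proof.
move=> t s u /asboolP[st ts] /asboolP[tu ut]; apply/asboolP.
by split; [exact: fiber_le_trans tu | exact: fiber_le_trans ts].
Qed.

Canonical fiber_equiv_rel :=
  EquivRel fiber_equiv fiber_equiv_refl fiber_equiv_sym fiber_equiv_trans.

Definition fiber_order := {eq_quot fiber_equiv_rel}.

HB.instance Definition _ := Choice.on fiber_order.

Definition fiber_order_le (a b : fiber_order) :=
  `[< fiber_le (val (repr a)) (val (repr b)) >].

Lemma fiber_repr (s : fiber) (a := \pi_fiber_order s) :
  fiber_le (val (repr a)) (val s) /\ fiber_le (val s) (val (repr a)).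
Proof.
apply/asboolP; apply/(@eqmodP _ fiber_equiv_rel (repr a) s).
by rewrite reprK.
Qed.

Lemma fiber_order_le_pi (s t : fiber) :
  fiber_order_le (\pi s) (\pi t) <-> fiber_le (val s) (val t).
Proof.
have [ss' s's] := fiber_repr s; have [tt' t't] := fiber_repr t.
split=> [/asboolP st|st]; [|apply/asboolP].
  exact: fiber_le_trans (fiber_le_trans s's st) tt'.
exact: fiber_le_trans (fiber_le_trans ss' st) t't.
Qed.

Lemma fiber_order_le_refl : reflexive fiber_order_le.
Proof. by move=> a; apply/asboolP; exact: fiber_le_refl. Qed.

Lemma fiber_order_le_anti : antisymmetric fiber_order_le.
Proof.
move=> a b /andP[/asboolP ab /asboolP ba].
by rewrite -[a]reprK -[b]reprK; apply/eqmodP/asboolP.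
Qed.

Lemma fiber_order_le_trans : transitive fiber_order_le.
Proof.
move=> b a c /asboolP ab /asboolP bc.
by apply/asboolP; exact: fiber_le_trans bc.
Qed.

HB.instance Definition _ := Order.Le_isPOrder.Build Order.default_display
  fiber_order fiber_order_le_refl fiber_order_le_anti fiber_order_le_trans.

End fiber_order.

Section prod_order.
Context (I : Type) (d : Order.disp_t) (T : I -> porderType d).

Definition prod_order := forall i, T i.

HB.instance Definition _ := gen_eqMixin prod_order.
HB.instance Definition _ := gen_choiceMixin prod_order.

Definition prod_order_le (a b : prod_order) := `[< forall i, (a i <= b i)%O >].

Lemma prod_order_le_refl : reflexive prod_order_le.
Proof. by move=> a; apply/asboolP. Qed.

Lemma prod_order_le_anti : antisymmetric prod_order_le.
Proof.
move=> a b /andP[/asboolP ab /asboolP ba].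
by apply: functional_extensionality_dep => i; apply/le_anti/andP.
Qed.

Lemma prod_order_le_trans : transitive prod_order_le.
Proof.
move=> b a c /asboolP ab /asboolP bc.
by apply/asboolP => i; exact: le_trans (bc i).
Qed.

HB.instance Definition _ := Order.Le_isPOrder.Build d prod_order
  prod_order_le_refl prod_order_le_anti prod_order_le_trans.

End prod_order.

Definition order_isomorphic d d' (A : porderType d) (B : porderType d') :=
  exists2 h : A -> B, bijective h & {mono h : a b / (a <= b)%O}.

(* Main.v *)
Require Import Defs.
From HB Require Import structures.
From mathcomp Require Import finmap lra.

(** Let P be the space of Radon probabilities on K.  A scattered compact space is
    zero-dimensional, and on it every finitely additive probability on the clopen
    sets extends to a Radon probability, since a diffuse part would have a
    support without isolated points (lemma [clopen_prob_radon]).  So a point of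
    P may be handled as a finitely additive function on clopen sets: the topology
    of P is that of pointwise convergence on clopen sets (lemma [radon_cvgP]),
    and P is compact (lemma [radon_prob_compact]).

    The quotients in the cofinal family identify two measures that agree on a
    countable family D of clopen sets.  Such quotients are cofinal by compactness
    (lemma [Qomega_agree]), and the supremum of countably many of them corresponds
    to the union of the families D.  (The quotients induced by quotients of K are
    not closed under suprema, because a measure on a subset of a product is not
    determined by its marginals.)  Fix countably many clopen sets that separate
    the points x_i.  The family D is required to be stable under intersection with the
    cylinders formed from them, and to contain these cylinders unless D is empty; the
    empty family gives the one-point quotient, the supremum of the empty family
    of quotients, for which both ordered sets are one-point sets.

    Let now D and D' be the families of L and L', and let nu agree with mu on D.
    As the cylinders around x_i decrease, their mu-mass, which is also their
    nu-mass, tends to r_i; hence nu is the sum of measures r_i eta_i, where eta_i is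
    carried by all cylinders around x_i and agrees with the Dirac mass at x_i on D
    (lemma [mixture_decompose]).  Conversely every such family of measures eta_i can
    be mixed (lemmas [mixture_exists] and [mixture_agree]).  So the fiber of mu is
    the product of the fibers of the Dirac masses.

    In terms of measures, s lies below t in the fiber order if every tau close to
    t on D' agrees on D with some measure close to s on D'.  That this may be
    tested on components is proved by cutting measures along small cylinders: from
    components to mixtures, cut tau along finitely many disjoint cylinders and
    correct each piece (lemma [fiber_dom_mixture]); from mixtures to components,
    graft a measure close to eta_i into a small cylinder around x_i (lemma
    [fiber_dom_component]).  Stability of D under intersection with cylinders makes
    these cuts compatible with agreement on D. *)

Set Implicit Arguments.
Unset Strict Implicit.
Unset Printing Implicit Defensive.

Import Order.TTheory GRing.Theory Num.Theory.

Local Open Scope classical_set_scope.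
Local Open Scope ring_scope.

(** * Compactness and clopen sets *)

(** The form in which every finite-subcover argument below is run: otherwise
    the sets outside of which [A] is small would form a filter on [A] without a
    cluster point. *)
Lemma compact_induction (T : topologicalType) (A : set T) (P : set T -> Prop) :
  compact A -> P set0 -> (forall U V, P U -> P V -> P (U `|` V)) ->
  (forall U V, V `<=` U -> P U -> P V) ->
  (forall x, A x -> exists2 U, nbhs x U & P U) -> P A.
Proof.
move=> cA P0 PU PS PA; apply: contrapT => nPA.
pose F : set_system T := [set U | P (A `\` U)].
have FF : ProperFilter F.
  split; first by move=> F0; apply: nPA; rewrite -[A]setD0.
  split=> [|U V FU FV|U V UV].
  - by rewrite /F/= setDT.
  - by rewrite /F/= setDIr; exact: PU.
  - by apply: PS; exact: setDS.
have FA : F A by rewrite /F/= setDv.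
have [x [Ax xF]] := cA F FF FA.
have [U xU UP] := PA _ Ax.
have FU : F (~` U) by rewrite /F/= setDE setCK; apply: PS UP => y [].
by have [y []] := xF _ _ FU xU.
Qed.

(** Let [Q] be the intersection of the clopen neighbourhoods of [x].  If [Q] had
    a second point, an isolated point [z] of [Q] could be separated from the rest
    of [Q] by disjoint open sets; by compactness a clopen neighbourhood of [x]
    lies in their union, and its trace on one of the two is a clopen
    neighbourhood of [x] that does not contain all of [Q]. *)
Lemma scattered_zero_dimensional (K : topologicalType) :
  hausdorff_space K -> compact [set: K] -> scattered K -> zero_dimensional K.
Proof.
move=> hK cK sK x y xy; apply: contrapT => nsep.
pose Q := \bigcap_(C in [set C | clopen C /\ C x]) C.
have Qy : Q y.
  by move=> C [cC Cx]; apply: contrapT => nCy; apply: nsep; exists C.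
have [z [/set_mem Qz [V zV VQ]]] : isolated Q !=set0.
  by apply: sK; exists x => C [].
have [A zA AV] : exists2 A, open_nbhs z A & closure A `<=` V.
  have [A zA AV] := compact_regular (x := z) hK cK filterT zV.
  exists A^°; first by split; [exact: open_interior|exact: zA].
  by apply: subset_trans AV; apply: closureS; exact: interior_subset.
have QV t : Q t -> V t -> t = z.
  by move=> Qt Vt; have : (V `&` Q) t by []; rewrite VQ.
pose B := ~` closure A.
have oB : open B by apply: closed_openC; exact: closed_closure.
have QAB : Q `<=` A `|` B.
  move=> t Qt; have [tA|] := pselect (closure A t); last by right.
  by left; rewrite (QV t Qt (AV _ tA)); exact: (proj2 zA).
have [C [cC Cx] CAB] : exists2 C, clopen C /\ C x & C `<=` A `|` B.
  pose P (T : set K) := exists2 C, clopen C /\ C x & C `<=` ~` T.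
  suff [C ? CP] : P (~` (A `|` B)) by exists C => //; rewrite setCK in CP.
  apply: compact_induction.
  - apply: subclosed_compact cK _ => //.
    by apply: open_closedC; apply: openU => //; exact: (proj1 zA).
  - by exists setT; [split => //; exact: clopenT|rewrite setC0].
  - move=> U W [C1 [cC1 C1x] C1U] [C2 [cC2 C2x] C2W]; exists (C1 `&` C2).
      by split => //; exact: clopenI.
    by rewrite setCU => t [/C1U ? /C2W].
  - by move=> U W WU [C1 ? C1U]; exists C1 => //; apply: subset_trans C1U _ ; exact: subsetC.
  - move=> t nABt; have /existsNP[C] : ~ Q t by move=> /QAB.
    move=> /not_implyP[[cC Cx] nCt]; exists (~` C).
      by apply: open_nbhs_nbhs; split => //; apply: closed_openC; exact: cC.2.
    by exists C => //; rewrite setCK.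
have CAE : C `&` A = C `\` B.
  apply/seteqP; split=> t [Ct].
    by move=> At; split => // Bt; apply: Bt; exact: subset_closure.
  by move=> nBt; split => //; case: (CAB t Ct).
have CBE : C `&` B = C `\` A.
  apply/seteqP; split=> t [Ct].
    by move=> Bt; split => // At; apply: Bt; exact: subset_closure.
  by move=> nBt; split => //; case: (CAB t Ct).
have [xA|nxA] := pselect (A x).
  have Qyx t : Q t -> t = z.
    move=> Qt; apply: QV => //; apply: AV; apply: subset_closure.
    suff : (C `&` A) t by case.
    apply: Qt; split => //; split; first by apply: openI; [exact: cC.1|exact: (proj1 zA)].
    by rewrite CAE; apply: closedI; [exact: cC.2|exact: open_closedC].
  have Qx : Q x by move=> D [].
  by move/eqP: xy; apply; rewrite (Qyx x)// (Qyx y).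
have : (C `&` B) z.
  apply: Qz; split; last by split => //; case: (CAB x Cx).
  split; first by apply: openI => //; exact: cC.1.
  by rewrite CBE; apply: closedI; [exact: cC.2|apply: open_closedC; exact: (proj1 zA)].
by move=> [_]; apply; apply: subset_closure; exact: (proj2 zA).
Qed.

Section clopen_sets.
Context (K : topologicalType).
Implicit Types U V C : set K.

Lemma clopenD U V : clopen U -> clopen V -> clopen (U `\` V).
Proof. by move=> cU cV; rewrite setDE; apply: clopenI => //; exact: (clopenC U). Qed.

Hypotheses (K_hausdorff : hausdorff_space K) (K_compact : compact [set: K]).
Hypothesis K_zero : zero_dimensional K.

Lemma clopen_base (x : K) (N : set K) : nbhs x N ->
  exists C, [/\ clopen C, C x & C `<=` N].
Proof.
move=> xN.
have /(_ N xN)[C [Cx cC] CN] :=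
  zero_dimensional_cvg K_hausdorff K_zero K_compact (x := x).
by exists C.
Qed.

Lemma clopen_nbhs C x : clopen C -> C x -> nbhs x C.
Proof. by move=> [oC _] Cx; exact: open_nbhs_nbhs. Qed.

(** A hereditary property that passes to disjoint unions holds globally as soon
    as it holds locally: finitely many clopen sets can be made disjoint. *)
Lemma clopen_induction (P : set K -> Prop) : P set0 ->
  (forall U V, clopen U -> clopen V -> V `<=` U -> P U -> P V) ->
  (forall U V, clopen U -> clopen V -> U `&` V = set0 ->
     P U -> P V -> P (U `|` V)) ->
  forall C, clopen C ->
  (forall x, C x -> exists U, [/\ clopen U, U x & P U]) -> P C.
Proof.
move=> P0 PS PU C cC PC.
suff [U cU [CU UP]] : exists2 U, clopen U & C `<=` U /\ P U by exact: PS UP.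
apply: (@compact_induction _ _ (fun T => exists2 U, clopen U & T `<=` U /\ P U)).
- by apply: subclosed_compact K_compact _ => //; exact: cC.2.
- by exists set0; [exact: clopen0|split].
- move=> U V [U' cU' [UU' PU']] [V' cV' [VV' PV']].
  exists (U' `|` V'); first exact: clopenU.
  split; first exact: setUSS.
  rewrite (_ : U' `|` V' = U' `|` (V' `\` U')); last by rewrite setDE setUIr setUv setIT.
  apply: PU => //; first exact: clopenD.
    by exact: setDIK.
  by apply: (PS V') => //; exact: clopenD.
- by move=> U V VU [U' ? [UU' ?]]; exists U' => //; split => //; exact: subset_trans UU'.
- move=> x Cx; have [U [cU Ux UP]] := PC _ Cx.
  by exists U; [exact: clopen_nbhs|exists U => //; split].
Qed.

End clopen_sets.

(** * Finitely additive probabilities on clopen sets *)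

(** Additivity is stated as cutting [C] along [W]: this is the form in which it
    is used, and it is immediate to check for the set function
    [C |-> n (C `&` V)]. *)
Record clopen_prob (K : topologicalType) (R : realType) (m : set K -> R) : Prop :=
  ClopenProb {
    cp_ge0 : forall C, clopen C -> 0 <= m C;
    cpID : forall C W, clopen C -> clopen W -> m C = m (C `&` W) + m (C `\` W);
    cpT : m setT = 1 }.

Section clopen_prob_theory.
Context (K : topologicalType) (R : realType) (m : set K -> R).
Hypothesis mP : clopen_prob m.
Implicit Types C U V W : set K.

Lemma cp0 : m set0 = 0.
Proof. by have := cpID mP clopen0 clopen0; rewrite setI0 setD0; lra. Qed.

Lemma cpS U V : clopen U -> clopen V -> U `<=` V -> m U <= m V.
Proof.
move=> cU cV UV; rewrite (cpID mP cV cU) (setIidr UV) lerDl.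
exact/(cp_ge0 mP)/clopenD.
Qed.

Lemma cpC C : clopen C -> m (~` C) = 1 - m C.
Proof.
by move=> cC; have := cpID mP clopenT cC; rewrite (cpT mP) setTI setTD; lra.
Qed.

Lemma cp_le1 C : clopen C -> m C <= 1.
Proof. by move=> cC; rewrite -(cpT mP); apply: cpS => //; exact: clopenT. Qed.

Lemma cpB U V : clopen U -> clopen V -> V `<=` U -> m (U `\` V) = m U - m V.
Proof. by move=> cU cV VU; rewrite (cpID mP cU cV) (setIidr VU); lra. Qed.

Lemma cp_sum_disjoint (I : eqType) (F : seq I) (W : I -> set K) C :
  clopen C -> (forall i, clopen (W i)) -> uniq F ->
  {in F &, forall i j, i != j -> W i `&` W j = set0} ->
  \sum_(i <- F) m (C `&` W i) <= m C.
Proof.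
move=> + cW; elim: F C => [|i F IH] C cC.
  by rewrite big_nil => _ _; exact: cp_ge0.
rewrite cons_uniq => /andP[iF uF] dW.
rewrite big_cons (cpID mP cC (cW i)) lerD2l.
rewrite (eq_big_seq (fun j => m ((C `\` W i) `&` W j))).
  apply: IH => //; first exact: clopenD.
  by move=> j k jF kF; apply: dW; rewrite inE ?jF ?kF orbT.
move=> j jF; congr m; rewrite setIDAC; congr (_ `&` _).
apply/esym/setDidl; apply: dW; rewrite ?inE ?jF ?eqxx ?orbT//.
by apply: contraNneq iF => <-.
Qed.

End clopen_prob_theory.

(** The lower estimates alone suffice, because complementation turns a lower
    estimate into an upper one; all approximations below are proved this way. *)
Lemma cp_near (K : topologicalType) (R : realType) (m n : set K -> R) C e :
  clopen_prob m -> clopen_prob n -> clopen C ->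
  n C - e < m C -> n (~` C) - e < m (~` C) -> `|m C - n C| < e.
Proof.
move=> mP nP cC; rewrite (cpC mP)// (cpC nP)// => h1 h2.
by rewrite ltr_norml; apply/andP; split; lra.
Qed.

Lemma cp_le_eq (K : topologicalType) (R : realType) (m n : set K -> R) C :
  clopen_prob m -> clopen_prob n -> clopen C ->
  n C <= m C -> n (~` C) <= m (~` C) -> m C = n C.
Proof. by move=> mP nP cC; rewrite (cpC mP)// (cpC nP)//; lra. Qed.

Section cval.
Context (K : ptopologicalType) (R : realType).
Implicit Types (nu : radon_prob K R) (C : set K).

Definition cval nu C : R := fine (nu C).

Lemma clopen_measurable C : clopen C -> measurable (C : set (borel K)).
Proof. by move=> [oC _]; exact: sub_sigma_algebra. Qed.

Lemma cvalE nu C : clopen C -> (cval nu C)%:E = nu C.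
Proof. by move=> cC; rewrite fineK// fin_num_measure//; exact: clopen_measurable. Qed.

Lemma cval_prob nu : clopen_prob (cval nu).
Proof.
split=> [C cC|C W cC cW|]; last by rewrite /cval probability_setT.
- by rewrite fine_ge0.
- apply: EFin_inj; rewrite EFinD !cvalE//; [|exact: clopenD|exact: clopenI].
  rewrite addeC [LHS](measureDI nu (clopen_measurable cC) (clopen_measurable cW)).
  by [].
Qed.

Lemma cval_dirac (x : K) C : cval (dirac_prob R x) C = (x \in C)%:R.
Proof. by rewrite /cval /dirac_prob/= /dirac indicE. Qed.

(** The sum of the weights over a set is by definition the supremum of its finite
    partial sums, and finite sets are compact: hence inner regularity holds on
    every subset. *)
Lemma radon_of_weights (w : K -> R) : (forall x, 0 <= w x) ->
  (\esum_(x in [set: K]) (w x)%:E = 1)%E ->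
  exists nu : radon_prob K R, forall A, nu A = (\esum_(x in A) (w x)%:E)%E.
Proof.
move=> w0 w1.
pose m (A : set (borel K)) := (\esum_(x in (A : set K)) (w x)%:E)%E.
have m0 : m set0 = 0%E by exact: esum_set0.
have m_ge0 A : (0 <= m A)%E by apply: esum_ge0 => x _; rewrite lee_fin.
have m_sigma : semi_sigma_additive m.
  move=> F mF tF mUF; rewrite /m nneseries_sum_bigcup//.
  by apply: is_cvg_nneseries => n _ _; exact: m_ge0.
pose mM := isMeasure.Build _ _ _ m m0 m_ge0 m_sigma.
pose mm : {measure set (borel K) -> \bar R} := HB.pack m mM.
have m1 : mm setT = 1%E by [].
pose pM := Measure_isProbability.Build _ _ _ mm m1.
pose pm : probability (borel K) R := HB.pack m mM pM.
have rpm : radon pm.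
  move=> A; rewrite [pm A]/(m A); apply/eqP; rewrite eq_le; apply/andP; split.
    apply: ge_ereal_sup => _ [F [finF FA] <-].
    rewrite -esum_fset//; last by move=> x _; rewrite lee_fin.
    apply: ereal_sup_ubound; exists F => //; split => //.
    exact: finite_compact.
  apply: ge_ereal_sup => _ [C [_ CA] <-]; rewrite [pm C]/(m C).
  apply: ge_ereal_sup => _ [F [finF FC] <-].
  by apply: ereal_sup_ubound; exists F => //; split => //; exact: subset_trans CA.
by exists (RadonProb rpm).
Qed.

End cval.

(** * Set functions on clopen sets are measures *)

Section realize.
Context (K : ptopologicalType) (R : realType).
Hypotheses (K_hausdorff : hausdorff_space K) (K_compact : compact [set: K]).
Hypothesis K_scattered : scattered K.

Let K_zero : zero_dimensional K.
Proof. exact: scattered_zero_dimensional. Qed.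

Variable m : set K -> R.
Hypothesis mP : clopen_prob m.

Let nb (x : K) := [set m U | U in [set U | clopen U /\ U x]].

Definition atom (x : K) : R := inf (nb x).

Let nb_inf x : has_inf (nb x).
Proof.
split; first by exists (m setT), setT => //; split => //; exact: clopenT.
by exists 0 => _ [U [cU _] <-]; exact: cp_ge0.
Qed.

Lemma atom_ge0 x : 0 <= atom x.
Proof.
by apply: lb_le_inf; [exact: (nb_inf x).1|move=> _ [U [cU _] <-]; exact: cp_ge0].
Qed.

Lemma atom_le x U : clopen U -> U x -> atom x <= m U.
Proof. by move=> cU Ux; apply: ge_inf; [exact: (nb_inf x).2|exists U]. Qed.

Lemma atom_approx x e : 0 < e -> exists U, [/\ clopen U, U x & m U < atom x + e].
Proof.
move=> e0; have [_ [U [cU Ux] <-] mU] := inf_adherent e0 (nb_inf x).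
by exists U.
Qed.

(** Cut [U] along a clopen neighbourhood of the first point that avoids the
    others. *)
Lemma sum_atom_le (s : seq K) U : clopen U -> uniq s ->
  (forall x, x \in s -> U x) -> \sum_(x <- s) atom x <= m U.
Proof.
elim: s U => [|x s IH] U cU; first by rewrite big_nil => _ _; exact: cp_ge0.
rewrite cons_uniq => /andP[xs us] sU.
have [V [cV Vx Vs]] : exists V, [/\ clopen V, V x & V `<=` ~` [set` s]].
  apply: (clopen_base K_hausdorff K_compact K_zero).
  apply: open_nbhs_nbhs; split; last exact/negP.
  apply: closed_openC; apply: compact_closed => //; apply: finite_compact.
  exact: finite_seq.
rewrite big_cons (cpID mP cU cV); apply: lerD.
  by apply: atom_le; [exact: clopenI|split=> //; apply: sU; rewrite mem_head].
apply: IH => //; first exact: clopenD.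
move=> y ys; split; first by apply: sU; rewrite inE ys orbT.
by move=> /Vs.
Qed.

Lemma esum_atom_le U : clopen U -> (\esum_(x in U) (atom x)%:E <= (m U)%:E)%E.
Proof.
move=> cU; apply: ge_ereal_sup => _ [F [finF FU] <-].
rewrite fsbig_finite//= sumEFin lee_fin; apply: sum_atom_le => //; first exact: fset_uniq.
by move=> x; rewrite in_fset_set// => /set_mem /FU.
Qed.

Let asum U : R := fine (\esum_(x in U) (atom x)%:E)%E.

Let asumE U : clopen U -> (asum U)%:E = (\esum_(x in U) (atom x)%:E)%E.
Proof.
move=> cU; rewrite fineK// ge0_fin_numE ?(le_lt_trans (esum_atom_le cU)) ?ltry//.
by apply: esum_ge0 => x _; rewrite lee_fin atom_ge0.
Qed.

Let asumID U V : clopen U -> clopen V -> asum U = asum (U `&` V) + asum (U `\` V).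
Proof.
move=> cU cV; apply: EFin_inj; rewrite EFinD !asumE//; last 2 first.
  exact: clopenD.
  exact: clopenI.
rewrite (esumID V)//; first by move=> x _; rewrite lee_fin atom_ge0.
Qed.

Let diffuse U := m U - asum U.

Let diffuse_ge0 U : clopen U -> 0 <= diffuse U.
Proof. by move=> cU; rewrite subr_ge0 -lee_fin asumE// esum_atom_le. Qed.

Let diffuseID U V : clopen U -> clopen V ->
  diffuse U = diffuse (U `&` V) + diffuse (U `\` V).
Proof.
by move=> cU cV; rewrite /diffuse (cpID mP cU cV) (asumID cU cV); lra.
Qed.

Let diffuseS U V : clopen U -> clopen V -> U `<=` V -> diffuse U <= diffuse V.
Proof.
move=> cU cV UV; rewrite (diffuseID cV cU) (setIidr UV) lerDl.
exact/diffuse_ge0/clopenD.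
Qed.

Let diffuse_local U : clopen U ->
  (forall x, U x -> exists V, [/\ clopen V, V x & diffuse V <= 0]) ->
  diffuse U <= 0.
Proof.
apply: (clopen_induction K_compact (P := fun U => diffuse U <= 0)).
- have := diffuseID clopen0 clopen0; rewrite setI0 setD0; lra.
- by move=> V W cV cW WV; apply: le_trans; exact: diffuseS.
- move=> V W cV cW VW V0 W0; rewrite (diffuseID (clopenU cV cW) cV).
  by rewrite setUK setUKD ?VW//; lra.
Qed.

Let diffuseT : diffuse setT = 0.
Proof.
apply/eqP; rewrite eq_le diffuse_ge0 ?andbT; last exact: clopenT.
rewrite leNgt; apply/negP => dT.
pose F := [set x | forall V, clopen V -> V x -> 0 < diffuse V].
have nF U : clopen U -> U `&` F = set0 -> diffuse U <= 0.
  move=> cU UF; apply: diffuse_local => // x Ux.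
  apply: contrapT => /forallNP h; suff : (U `&` F) x by rewrite UF.
  split => // V cV Vx; rewrite ltNge; apply/negP => V0.
  by apply: (h V).
have [x [/set_mem Fx [N xN NF]]] : isolated F !=set0.
  apply: K_scattered; apply/set0P/negP => /eqP F0.
  by have := nF setT clopenT; rewrite F0 setI0 => /(_ erefl); lra.
have [U [cU Ux UN]] := clopen_base K_hausdorff K_compact K_zero xN.
have [V [cV Vx mV]] := atom_approx x (Fx U cU Ux).
have cUV := clopenI cU cV.
(* [x] is the only point of the support in [U], so [U] minus any clopen
   neighbourhood of [x] is null. *)
have UV0 : diffuse (U `\` (U `&` V)) <= 0.
  apply: nF; first exact: clopenD.
  rewrite -subset0 => y [[Uy nUVy] Fy].
  have : (N `&` F) y by split => //; exact: UN.
  by rewrite NF => yx; apply: nUVy; rewrite yx.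
have := diffuseID cU cUV; rewrite (setIidr (@subIsetl _ U V)) => dU.
have mUV : m (U `&` V) <= m V by apply: (cpS mP) => //; exact: subIsetr.
have aUV : atom x <= asum (U `&` V).
  rewrite -lee_fin asumE//; apply: ereal_sup_ubound; exists [set x].
    by split; [exact: finite_set1|move=> _ ->].
  by rewrite fsbig_set1.
have : diffuse (U `&` V) = m (U `&` V) - asum (U `&` V) by [].
by move: UV0 dU mUV aUV mV; lra.
Qed.

(** On a scattered compact space a finitely additive probability on the clopen
    sets is carried by its atoms.  Subtracting the atoms leaves a nonnegative
    additive diffuse part; its support is closed, and at an isolated point
    of the support all the local mass would sit in that single point, which would
    be an atom.  So the support is empty.  Thus Radon probabilities can be
    constructed by giving their values on clopen sets only. *)
Lemma clopen_prob_radon : exists nu : radon_prob K R,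
  forall C, clopen C -> cval nu C = m C.
Proof.
have mE C : clopen C -> asum C = m C.
  move=> cC; apply/eqP; rewrite eq_sym -subr_eq0 eq_le diffuse_ge0// andbT.
  by rewrite -diffuseT; apply: diffuseS => //; exact: clopenT.
have [|nu nuE] := radon_of_weights atom_ge0.
  by rewrite -asumE ?mE ?(cpT mP)//; exact: clopenT.
by exists nu => C cC; rewrite /cval nuE -[RHS]mE.
Qed.

End realize.

(** * The weak topology through clopen sets *)

Section weak_topology.
Context (K : ptopologicalType) (R : realType).
Hypotheses (K_hausdorff : hausdorff_space K) (K_compact : compact [set: K]).

Implicit Types (nu tau : radon_prob K R) (f : continuousType K R).

Lemma continuous_borel_measurable (f : K -> R) : continuous f ->
  measurable_fun [set: borel K] f.
Proof.
move=> /continuousP cf _.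
apply: (measurability _ (measurable_realfun.RGenOpens.measurableE R)) => //.
move=> _ [_ [a [b ->] <-]]; rewrite setTI; apply: sub_sigma_algebra.
exact/cf/interval_open.
Qed.

Lemma continuous_integrable (f : K -> R) nu (A : set (borel K)) : continuous f ->
  measurable A -> nu.-integrable A (EFin \o f).
Proof.
move=> cf mA; apply: (@integrableS _ _ _ _ setT) => //.
apply: measurable_bounded_integrable => //.
- by rewrite ltey_eq fin_num_measure.
- exact: continuous_borel_measurable.
- have : bounded_set (f @` [set: K]).
    apply: compact_bounded; apply: continuous_compact => //.
    by apply: continuous_subspaceT.
  move=> [M [Mr MP]]; exists M; split => // x Mx y _.
  by apply: MP => //; exists y.
Qed.

Hypothesis K_zero : zero_dimensional K.

(** The integral over [V] is approximated, within [e] times the mass of [V], by one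
    finite combination of clopen values, the same for all measures at once. *)
Definition step_approx f (e : R) (V : set K) := exists2 s : seq (R * set K),
  (forall p, p \in s -> clopen p.2) & forall tau,
  `|\int[tau]_(x in (V : set (borel K))) f x - \sum_(p <- s) p.1 * cval tau p.2|
    <= e * cval tau V.

Lemma step_approximation f e : 0 < e -> step_approx f e setT.
Proof.
move=> e0; suff : forall V, clopen V -> V `<=` setT -> step_approx f e V.
  by apply => //; exact: clopenT.
(* The approximation itself is not hereditary; quantifying over the clopen
   subsets makes it so. *)
pose P U := forall V, clopen V -> V `<=` U -> step_approx f e V.
apply: (clopen_induction K_compact (P := P)).
- move=> V _; rewrite subset0 => ->; exists [::] => // tau.
  by rewrite big_nil Rintegral_set0 subrr normr0 (cp0 (cval_prob tau)) mulr0.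
- by move=> U V cU cV VU PU W cW WV; apply: PU => //; exact: subset_trans VU.
- move=> U V cU cV UV PU PV W cW WUV.
  have WE : W = (W `&` U) `|` (W `\` U) by rewrite setUIDK.
  have [s sc sP] := PU (W `&` U) (clopenI cW cU) (@subIsetr _ _ _).
  have [|s' sc' sP'] := PV (W `\` U) (clopenD cW cU).
    by move=> x [/WUV[]].
  exists (s ++ s') => [p|tau]; first by rewrite mem_cat => /orP[/sc|/sc'].
  rewrite big_cat/= {1}WE Rintegral_setU; last 4 first.
  + by apply: clopen_measurable; apply: clopenI.
  + by apply: clopen_measurable; apply: clopenD.
  + apply: continuous_integrable; first exact: cts_fun.
    by rewrite -WE; exact: clopen_measurable.
  + by apply/disj_setPS => x [[_ Ux] [_]]; apply.
  rewrite (cpID (cval_prob tau) cW cU) mulrDr opprD addrACA.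
  by rewrite (le_trans (ler_normD _ _))// lerD.
- exact: clopenT.
- move=> x _.
  have /(clopen_base K_hausdorff K_compact K_zero)[U [cU Ux UP]] :
      nbhs x [set y | `|f x - f y| < e].
    have /cvgrPdist_lt/(_ _ e0) := @cts_fun _ _ f x; exact.
  exists U; split => // V cV VU; exists [:: (f x, V)].
    by move=> p; rewrite inE => /eqP ->.
  move=> tau; rewrite big_seq1/=.
  have mV := clopen_measurable cV.
  have iV (c : R) : tau.-integrable (V : set (borel K)) (EFin \o cst c).
    exact: finite_measure_integrable_cst.
  rewrite -(Rintegral_cst tau mV) -(Rintegral_cst tau mV e) -RintegralB//; last 2 first.
  + by apply: continuous_integrable => //; exact: cts_fun.
  + exact: iV.
  apply: le_trans.
    apply: le_normr_Rintegral => //.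
    apply: (continuous_integrable (f := fun y => f y - f x)) => // y.
    by apply: cvgB; [exact: cts_fun|exact: cvg_cst].
  apply: le_Rintegral => //.
  + apply: (continuous_integrable (f := fun y => `|f y - f x|)) => // y.
    by apply: cvg_norm; apply: cvgB; [exact: cts_fun|exact: cvg_cst].
  + exact: iV.
  + by move=> y /VU /UP /ltW; rewrite distrC.
Qed.

Lemma radon_eval_continuous f : continuous (fun nu => radon_eval nu f).
Proof.
move=> nu; apply: (@continuous_comp _ _ _ (@radon_eval K R) (fun g => g f)).
  exact: (@initial_continuous _ _ (@radon_eval K R)).
exact: (@proj_continuous _ (fun=> R) f).
Qed.

Lemma cval_continuous C : clopen C -> continuous (fun nu => cval nu C).
Proof.
move=> cC.
have cI : continuous (\1_C : K -> R).
  move=> x; apply: cvg_near_cst; have [Cx|nCx] := pselect (C x).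
    have := clopen_nbhs cC Cx; apply: filterS => y Cy.
    by rewrite !indicE !mem_set.
  have := clopen_nbhs (clopenC C cC) nCx; apply: filterS => y nCy.
  by rewrite !indicE !memNset.
rewrite (_ : (fun nu => cval nu C) = (fun nu => radon_eval nu (mkcts cI))).
  exact: radon_eval_continuous.
apply/funext => nu; rewrite /radon_eval /Rintegral /mkcts/= integral_indic ?setIT//.
exact: clopen_measurable.
Qed.

(** Convergence on clopen sets is enough: clopen step functions approximate
    continuous functions uniformly. *)
Lemma radon_cvgP (F : set_system (radon_prob K R)) nu : Filter F ->
  (forall C, clopen C -> cval tau C @[tau --> F] --> cval nu C) -> F --> nu.
Proof.
move=> FF Fnu.
have Fr : (@radon_eval K R @ F) --> radon_eval nu.
  rewrite cvg_sup => f.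
  rewrite cvg_image; last by rewrite eqEsubset; split=> v // _; exists (cst v).
  suff : radon_eval tau f @[tau --> F] --> radon_eval nu f.
    apply: cvg_trans => A /= FA; exists ((fun g => g f) @^-1` A) => //.
    by rewrite eqEsubset; split=> [_ [g + <-]//|v Av]; exists (cst v).
  apply/cvgrPdist_lt => e e0.
  have e4 : 0 < e / 4 by lra.
  have [s sc sP] := step_approximation f e4.
  pose S tau := \sum_(p <- s) p.1 * cval tau p.2.
  have cS : S tau @[tau --> F] --> S nu.
    rewrite /S; under eq_fun do rewrite big_seq.
    rewrite big_seq; apply: cvg_big => [|p ps]; first exact: add_continuous.
    by apply: cvgMr; apply: Fnu; exact: sc.
  have Fe : F [set tau | `|S nu - S tau| < e / 4].
    by move/cvgrPdist_lt : cS => /(_ _ e4).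
  apply: (filterS _ Fe) => tau /= St.
  have := sP nu; have := sP tau.
  rewrite !(cpT (cval_prob _)) !mulr1 -!/(S _) -!/(radon_eval _ _).
  move: St; rewrite !ler_norml !ltr_norml => /andP[h1 h2] /andP[h3 h4] /andP[h5 h6].
  by apply/andP; split; lra.
move=> N; rewrite nbhsE => -[B [[W oW <-] Onu] BN].
have FO : (@radon_eval K R @ F) W by apply: Fr; exact: open_nbhs_nbhs.
by apply: (@filterS _ F FF (@radon_eval K R @^-1` W)) FO => tau Wtau; exact: BN.
Qed.

End weak_topology.

(** * Compactness of the space of probabilities *)

Section compactness.
Context (K : ptopologicalType) (R : realType).
Hypotheses (K_hausdorff : hausdorff_space K) (K_compact : compact [set: K]).
Hypothesis K_scattered : scattered K.
Let K_zero : zero_dimensional K.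
Proof. exact: scattered_zero_dimensional. Qed.

(** Along an ultrafilter the value of each clopen set converges, the limits form
    a finitely additive probability, and such a probability is a measure. *)
Lemma radon_prob_compact : compact [set: radon_prob K R].
Proof.
rewrite compact_ultra => F FU _.
pose m (C : set K) := lim (cval tau C @[tau --> F]).
have mE C : clopen C -> cval tau C @[tau --> F] --> m C.
  move=> cC.
  pose G := cval tau C @[tau --> F].
  have G01 : G (`[0%R, 1%R]%classic).
    apply: (@filterS _ F _ setT) filterT => tau _ /=; rewrite in_itv/=.
    by rewrite (cp_ge0 (cval_prob tau) cC) (cp_le1 (cval_prob tau) cC).
  have [l [_ Gl]] := @segment_compact R 0 1 G _ G01.
  suff Fl : G --> l by apply: cvgP Fl.
  move=> N lN; have [//|FN] := in_ultra_setVsetC ((fun tau => cval tau C) @^-1` N) FU.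
  by have [y []] := Gl (~` N) N FN lN.
have mP : clopen_prob m.
  split.
  - move=> C cC; rewrite /m; apply: limr_ge; first by apply: cvgP; exact: mE.
    by apply: nearW => tau; exact: (cp_ge0 (cval_prob tau)).
  - move=> C W cC cW; apply: cvg_lim; first exact: Rhausdorff.
    rewrite (_ : (fun tau => cval tau C) =
      (fun tau => cval tau (C `&` W) + cval tau (C `\` W))); last first.
      by apply/funext => tau; rewrite (cpID (cval_prob tau) cC cW).
    by apply: cvgD; apply: mE; [exact: clopenI|exact: clopenD].
  - apply: cvg_lim; first exact: Rhausdorff.
    rewrite (_ : (fun _ => _) = cst 1); first exact: cvg_cst.
    by apply/funext => tau; rewrite (cpT (cval_prob tau)).
have [nu nuE] := clopen_prob_radon K_hausdorff K_compact K_scattered mP.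
exists nu; split => //; apply: (radon_cvgP K_hausdorff K_compact K_zero) => C cC.
by rewrite nuE//; exact: mE.
Qed.

End compactness.

(** * Quotients by the values on a family of clopen sets *)

Section agree.
Local Open Scope quotient_scope.
Context (K : ptopologicalType) (R : realType).
Notation P := (radon_prob K R).
Implicit Types (s t u : P) (D : set (set K)).

Definition agree D s t := forall C, D C -> cval s C = cval t C.

Definition agreeb D s t : bool := `[< agree D s t >].

Lemma agreeb_refl D : reflexive (agreeb D).
Proof. by move=> s; apply/asboolP. Qed.

Lemma agreeb_sym D : symmetric (agreeb D).
Proof. by move=> s t; apply/asboolP/asboolP => st C DC; rewrite st. Qed.

Lemma agreeb_trans D : transitive (agreeb D).
Proof.
by move=> t s u /asboolP st /asboolP tu; apply/asboolP => C DC; rewrite st ?tu.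
Qed.

Definition agree_rel D : equiv_rel P :=
  EquivRel (agreeb D) (@agreeb_refl D) (@agreeb_sym D) (@agreeb_trans D).

Lemma agree_relE D s t : agree_rel D s t <-> agree D s t.
Proof. by split=> [/asboolP|?]; last exact/asboolP. Qed.

Definition clopen_ball (t : P) (s : seq (set K)) (e : R) : set P :=
  [set u | forall C, C \in s -> `|cval u C - cval t C| < e].

Lemma clopen_ball_refl t (s : seq (set K)) (e : R) : 0 < e -> clopen_ball t s e t.
Proof. by move=> e0 C _; rewrite subrr normr0. Qed.

Lemma clopen_ballS t (s s' : seq (set K)) (e e' : R) :
  (forall C, C \in s -> C \in s') -> e' <= e ->
  clopen_ball t s' e' `<=` clopen_ball t s e.
Proof. by move=> ss ee u us C Cs; apply: lt_le_trans (us _ (ss _ Cs)) ee. Qed.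

Hypotheses (K_hausdorff : hausdorff_space K) (K_compact : compact [set: K]).
Hypothesis K_scattered : scattered K.

Lemma cval_interval_open C a b : clopen C -> open [set u : P | a < cval u C < b].
Proof.
move=> cC; rewrite (_ : [set _ | _] = (fun u => cval u C) @^-1` `]a, b[).
  by apply: open_comp; [move=> + _; exact: cval_continuous|exact: interval_open].
by apply/seteqP; split => u /=; rewrite in_itv.
Qed.

Lemma clopen_ball_open t (s : seq (set K)) (e : R) :
  (forall C, C \in s -> clopen C) -> open (clopen_ball t s e).
Proof.
elim: s => [|C s IH] sc.
  rewrite (_ : clopen_ball t [::] e = setT); first exact: openT.
  by apply/seteqP; split.
rewrite (_ : clopen_ball t (C :: s) e =
    [set u : P | cval t C - e < cval u C < cval t C + e] `&` clopen_ball t s e).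
  apply: openI; first by apply: cval_interval_open; apply: sc; rewrite mem_head.
  by apply: IH => C' C's; apply: sc; rewrite inE C's orbT.
apply/seteqP; split => u.
  move=> uCs; split; last by move=> C' C's; apply: uCs; rewrite inE C's orbT.
  by have := uCs C (mem_head _ _); rewrite ltr_distl.
by move=> [/= uC us] C'; rewrite inE => /predU1P[->|/us//]; rewrite ltr_distl.
Qed.

Section one_quotient.
Context (L : equiv_rel P) (D : set (set K)).
Hypothesis LD : forall s t, L s t <-> agree D s t.
Hypothesis D_clopen : forall C, D C -> clopen C.

(** The topology of the quotient is that of pointwise convergence on [D]: the
    complement of an open saturated set is compact, and finitely many members of
    [D] keep all its points away from [t]. *)
Lemma quot_nbhs t (N : set (quot L)) : nbhs (quot_proj L t) N ->
  exists (s : seq (set K)) (e : R), [/\ forall C, C \in s -> D C, 0 < e &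
    forall u, clopen_ball t s e u -> N (quot_proj L u)].
Proof.
rewrite nbhsE => -[B [oB Bt] BN].
pose W := quot_proj L @^-1` B.
have oW : open W by exact: oB.
pose Q (T : set P) := exists (s : seq (set K)) (e : R),
  [/\ forall C, C \in s -> D C, 0 < e & forall u, T u -> ~ clopen_ball t s e u].
suff [s [e [sD e0 sW]]] : Q (~` W).
  exists s, e; split => // u us; apply: BN.
  by apply: contrapT => nBu; apply: (sW u).
apply: compact_induction.
- by apply: subclosed_compact (radon_prob_compact _ _ _) _ => //; exact: open_closedC.
- by exists [::], 1; split.
- move=> U V [s [e [sD e0 sU]]] [s' [e' [sD' e'0 sV]]].
  exists (s ++ s'), (Order.min e e'); split.
  + by move=> C; rewrite mem_cat => /orP[/sD|/sD'].
  + by rewrite lt_min e0.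
  + move=> u [/sU|/sV] h ub; apply: h; apply: clopen_ballS ub.
    * by move=> C Cs; rewrite mem_cat Cs.
    * by rewrite ge_min lexx.
    * by move=> C Cs; rewrite mem_cat Cs orbT.
    * by rewrite ge_min lexx orbT.
- move=> U V VU [s [e [sD e0 sU]]]; exists s, e; split => // u /VU; exact: sU.
- move=> u nWu; have : ~ agree D u t.
    by move=> /LD /quot_projE ut; apply: nWu; rewrite /W/= ut.
  move=> /existsNP[C /not_implyP[DC /eqP utC]].
  pose e := `|cval u C - cval t C| / 2.
  have e0 : 0 < e by rewrite divr_gt0// normr_gt0 subr_eq0.
  exists (clopen_ball u [:: C] e).
    apply: open_nbhs_nbhs; split; last exact: clopen_ball_refl.
    by apply: clopen_ball_open => C'; rewrite inE => /eqP ->; exact: D_clopen.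
  exists [:: C], e; split => //; first by move=> C'; rewrite inE => /eqP ->.
  move=> v /(_ C (mem_head _ _)) vu /(_ C (mem_head _ _)) vt.
  have := ler_distD (cval v C) (cval u C) (cval t C).
  rewrite [X in _ <= X + _]distrC leNgt => /negP; apply.
  rewrite (_ : `|cval u C - cval t C| = e + e); first exact: ltrD.
  by rewrite /e; lra.
Qed.

Lemma quot_nbhs_ball t (s : seq (set K)) (e : R) (N : set (quot L)) :
  (forall C, C \in s -> D C) ->
  0 < e -> (forall u, clopen_ball t s e u -> N (quot_proj L u)) ->
  nbhs (quot_proj L t) N.
Proof.
move=> sD e0 tN; rewrite nbhsE; exists (quot_proj L @` clopen_ball t s e); last first.
  by move=> _ [u tu <-]; exact: tN.
split; last by exists t => //; exact: clopen_ball_refl.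
suff : open (quot_proj L @^-1` (quot_proj L @` clopen_ball t s e)) by [].
rewrite (_ : _ @^-1` _ = clopen_ball t s e).
  by apply: clopen_ball_open => C /sD; exact: D_clopen.
apply/seteqP; split=> [u [v tv /quot_projE/LD vu] C Cs|u tu]; last by exists u.
by rewrite -(vu _ (sD _ Cs)); exact: tv.
Qed.

Lemma quot_surj (z : quot L) : exists t, quot_proj L t = z.
Proof. by exists (repr z); rewrite /quot_proj reprK. Qed.

Lemma agree_quot_hausdorff : hausdorff_space (quot L).
Proof.
move=> p q; have [s <-] := quot_surj p; have [t <-] := quot_surj q => st.
apply/quot_projE/LD => C DC; apply/eqP; rewrite -subr_eq0 -normr_le0 leNgt.
apply/negP => st0; pose e := `|cval s C - cval t C| / 2.
have e0 : 0 < e by rewrite divr_gt0.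
have nb v : nbhs (quot_proj L v) (quot_proj L @` clopen_ball v [:: C] e).
  apply: (@quot_nbhs_ball v [:: C] e) => //.
    by move=> C'; rewrite inE => /eqP ->.
have [z [[u su <-] [v tv /quot_projE/LD vu]]] := st _ _ (nb s) (nb t).
have := ler_distD (cval v C) (cval s C) (cval t C).
rewrite leNgt => /negP; apply.
rewrite (_ : `|cval s C - cval t C| = e + e); last by rewrite /e; lra.
apply: ltrD; last by apply: tv; exact: mem_head.
by rewrite (vu _ DC) distrC; apply: su; exact: mem_head.
Qed.

Lemma agree_quot_second_countable : countable D -> @second_countable (quot L).
Proof.
move=> /countable_injP[f finj].
(* Basic sets bound finitely many values between rationals; the members of [D]
   are named by their numbers under the injection [f]. *)
pose W (s : seq (nat * rat * rat)) := [set z : quot L | forall n a b,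
  (n, a, b) \in s -> forall C, D C -> f C = n ->
  ratr a < cval (repr z) C < ratr b].
have Wrepr (s : seq (nat * rat * rat)) u : W s (quot_proj L u) <-> forall n a b, (n, a, b) \in s ->
    forall C, D C -> f C = n -> ratr a < cval u C < ratr b.
  have ru : agree D (repr (quot_proj L u)) u.
    by apply/LD/quot_projE; rewrite {1}/quot_proj reprK.
  by split=> h n a b nab C DC fC; have := h n a b nab C DC fC; rewrite (ru _ DC).
exists (range W); first by apply: sub_countable (card_image_le _ _) (countableP _).
split.
  move=> _ [s _ <-]; suff : open (quot_proj L @^-1` W s) by [].
  elim: s => [|[[n a] b] s IH].
    rewrite (_ : quot_proj L @^-1` W [::] = setT); first exact: openT.
    by apply/seteqP; split.
  have [[C [DC fC]]|nC] := pselect (exists C, D C /\ f C = n).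
    rewrite (_ : quot_proj L @^-1` W ((n, a, b) :: s) =
      [set u : P | ratr a < cval u C < ratr b] `&` quot_proj L @^-1` W s).
      by apply: openI => //; apply: cval_interval_open; exact: D_clopen.
    apply/seteqP; split=> u.
      move=> /Wrepr h; split; first by apply: (h n) => //; exact: mem_head.
      by apply/Wrepr => n' a' b' s'; apply: h; rewrite inE s' orbT.
    move=> [/= uC /Wrepr us]; apply/Wrepr => n' a' b'; rewrite inE.
    move=> /predU1P[[-> -> ->] C' DC' fC'|]; last exact: us.
    suff -> : C' = C by [].
    by apply: finj; [exact: mem_set|exact: mem_set|rewrite fC'].
  rewrite (_ : quot_proj L @^-1` W ((n, a, b) :: s) = quot_proj L @^-1` W s)//.
  apply/seteqP; split=> u /Wrepr h; apply/Wrepr => n' a' b'.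
    by move=> s'; apply: h; rewrite inE s' orbT.
  rewrite inE => /predU1P[[-> _ _] C' DC' fC'|]; last exact: h.
  by exfalso; apply: nC; exists C'.
move=> z N; have [t <-] := quot_surj z => /quot_nbhs[s [e [sD e0 tN]]].
suff [s' [s't s'N]] : exists s' : seq (nat * rat * rat), (W s' (quot_proj L t)) /\
    forall u, W s' (quot_proj L u) -> clopen_ball t s e u.
  exists (W s'); first by split => //; exists s'.
  by move=> y; have [u <-] := quot_surj y => /s'N; exact: tN.
elim: s sD {tN} => [|C s IH] sD; first by exists [::]; split => //; apply/Wrepr.
have [|s' [/Wrepr s't s'N]] := IH.
  by move=> C' C's; apply: sD; rewrite inE C's orbT.
have DC : D C by apply: sD; rewrite mem_head.
have [a] : exists a : rat, cval t C - e < ratr a < cval t C.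
  have : cval t C - e < cval t C by lra.
  by move=> /rat_in_itvoo[a]; rewrite in_itv/= => ?; exists a.
have [b] : exists b : rat, cval t C < ratr b < cval t C + e.
  have : cval t C < cval t C + e by lra.
  by move=> /rat_in_itvoo[b]; rewrite in_itv/= => ?; exists b.
move=> /andP[tb be] /andP[ea at_].
exists ((f C, a, b) :: s'); split.
  apply/Wrepr => n' a' b'; rewrite inE => /predU1P[[-> -> ->] C' DC' fC'|].
    have -> : C' = C by apply: finj => //; exact: mem_set.
    by rewrite tb at_.
  exact: s't.
move=> u /Wrepr us C'; rewrite inE => /predU1P[->|]; last first.
  apply: (s'N u) => //; apply/Wrepr => n' a' b' s''; apply: us.
  by rewrite inE s'' orbT.
rewrite ltr_distl; have /andP[au ub] := us _ _ _ (mem_head _ _) C DC erefl.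
by rewrite (lt_trans ea au) (lt_trans ub be).
Qed.

Lemma agree_Qomega : countable D -> Qomega L.
Proof.
move=> cD; split; first exact: agree_quot_hausdorff.
exact: agree_quot_second_countable.
Qed.

End one_quotient.

(** Measures with the same clopen values are topologically indistinguishable, so
    a Hausdorff quotient identifies them. *)
Lemma clopen_separation (L : equiv_rel P) u v : hausdorff_space (quot L) ->
  (forall C, clopen C -> cval u C = cval v C) -> L u v.
Proof.
move=> hL uv; apply/quot_projE/hL => A B uA vB; exists (quot_proj L v).
split; last exact: nbhs_singleton.
have K_zero := scattered_zero_dimensional K_hausdorff K_compact K_scattered.
have vu : principal_filter v --> u.
  apply: (radon_cvgP K_hausdorff K_compact K_zero) => C cC.
  by rewrite (uv C cC) => N /nbhs_singleton Nv; exact/principal_filterP.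
have : nbhs u (quot_proj L @^-1` A) by exact: (@pi_continuous _ {eq_quot L}).
by move=> /vu /principal_filterP.
Qed.

Lemma compact_clopen_separation (A B : set P) : compact A -> compact B ->
  (forall u v, A u -> B v -> exists2 C, clopen C & cval u C != cval v C) ->
  exists2 s : seq (set K), (forall C, C \in s -> clopen C) &
    forall u v, A u -> B v -> exists2 C, C \in s & cval u C != cval v C.
Proof.
move=> cA cB AB.
pose Q (T : set (P * P)) := exists2 s : seq (set K),
  (forall C, C \in s -> clopen C) &
  forall p, T p -> exists2 C, C \in s & cval p.1 C != cval p.2 C.
suff [s sc sP] : Q (A `*` B) by exists s => // u v Au Bv; exact: (sP (u, v)).
apply: compact_induction; first exact: compact_setX.
- by exists [::].
- move=> U V [s sc sU] [s' sc' sV]; exists (s ++ s').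
    by move=> C; rewrite mem_cat => /orP[/sc|/sc'].
  move=> p [/sU|/sV] [C Cs pC]; exists C => //; rewrite mem_cat Cs ?orbT//.
- by move=> U V VU [s sc sU]; exists s => // p /VU; exact: sU.
- move=> [u v] [/= Au Bv]; have [C cC uvC] := AB u v Au Bv.
  pose e := `|cval u C - cval v C| / 2.
  have e0 : 0 < e by rewrite divr_gt0// normr_gt0 subr_eq0.
  have nb w : nbhs w (clopen_ball w [:: C] e).
    apply: open_nbhs_nbhs; split; last exact: clopen_ball_refl.
    by apply: clopen_ball_open => C'; rewrite inE => /eqP ->.
  exists (clopen_ball u [:: C] e `*` clopen_ball v [:: C] e).
    by exists (clopen_ball u [:: C] e, clopen_ball v [:: C] e).
  exists [:: C]; first by move=> C'; rewrite inE => /eqP ->.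
  move=> [u' v'] [/= uu' vv']; exists C; first exact: mem_head.
  have hu := uu' _ (mem_head _ _); have hv := vv' _ (mem_head _ _).
  apply: contraTneq hu => u'v'; rewrite -leNgt u'v'.
  have := ler_distD (cval v' C) (cval u C) (cval v C).
  rewrite [X in _ <= X + _]distrC => h.
  have : `|cval u C - cval v C| = e + e by rewrite /e; lra.
  lra.
Qed.

(** Points with different classes lie in basic open sets of the quotient with
    disjoint closures.  The preimages of these closures are disjoint compact sets,
    told apart by finitely many clopen sets; a countable basis has only
    countably many pairs of members. *)
Lemma Qomega_agree (L : equiv_rel P) : Qomega L -> exists D : set (set K),
  [/\ countable D, D `<=` clopen & forall s t, agree D s t -> L s t].
Proof.
move=> [hL [B cB [oB bB]]].
have cP : compact [set: P] by exact: radon_prob_compact.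
have pc : continuous (quot_proj L) by exact: (@pi_continuous _ {eq_quot L}).
have cL : compact [set: quot L].
  rewrite (_ : setT = quot_proj L @` setT).
    by apply: continuous_compact => //; exact: continuous_subspaceT.
  by apply/seteqP; split=> // z _; have [t <-] := quot_surj z; exists t.
pose sep (p : set (quot L) * set (quot L)) (s : seq (set K)) :=
  forall u v : P, p.1 (quot_proj L u) -> p.2 (quot_proj L v) ->
  exists2 C, C \in s & cval u C != cval v C.
have /choice[sg sgP] : forall p, exists s : seq (set K),
    (forall C, C \in s -> clopen C) /\
    ((exists2 s, (forall C, C \in s -> clopen C) & sep p s) -> sep p s).
  move=> p; have [[s sc ps]|np] := pselect (exists2 s, (forall C, C \in s -> clopen C) & sep p s).
    by exists s.
  by exists [::].
exists (\bigcup_(p in B `*` B) [set` sg p]); split.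
- apply: bigcup_countable; first exact: countableX.
  by move=> p _; apply: finite_set_countable; exact: finite_seq.
- by move=> C [p _ /=]; exact: (sgP p).1.
move=> s t st; apply: contrapT => nst.
have pst : quot_proj L s != quot_proj L t by apply/eqP => /quot_projE.
have := hL; rewrite open_hausdorff => /(_ _ _ pst).
case=> -[A A'] /= [/set_mem sA /set_mem tA'] [oA oA' /eqP AA'].
have basis_closure z (N : set (quot L)) : nbhs z N ->
    exists2 b, B b /\ b z & closure b `<=` N.
  move=> /(compact_regular hL cL filterT)[V zV VN].
  have [b [Bb bz] bV] := bB z V zV.
  by exists b => //; apply: subset_trans VN; exact: closureS.
have [b [Bb bs] bA] := basis_closure _ _ (open_nbhs_nbhs (conj oA sA)).
have [b' [Bb' bt] bA'] := basis_closure _ _ (open_nbhs_nbhs (conj oA' tA')).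
have cpt (c : set (quot L)) : compact (quot_proj L @^-1` closure c).
  apply: subclosed_compact cP _ => //; apply: preimage_closed => //.
  exact: closed_closure.
have [|s0 s0c s0P] := compact_clopen_separation (cpt b) (cpt b').
  move=> u v bu bv; apply: contrapT => uv.
  have /quot_projE Luv : L u v.
    apply: clopen_separation => // C cC; apply: contrapT => /eqP uvC.
    by apply: uv; exists C.
  suff : (A `&` A') (quot_proj L u) by rewrite AA'.
  by split; [exact: bA|rewrite Luv; exact: bA'].
have [] := (sgP (b, b')).2 _ s t bs bt.
  exists s0 => // u v bu bv; apply: s0P; exact: subset_closure.
by move=> C Csg /eqP; apply; apply: st; exists (b, b').
Qed.

End agree.

(** * Clopen cylinders *)

Section finite_choices.
Context (I : eqType) (R : realType).

Lemma seq_lower_bound (F : seq I) (f : I -> R) : (forall i, 0 < f i) ->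
  exists2 d, 0 < d & forall i, i \in F -> d <= f i.
Proof.
move=> f0; elim: F => [|i F [d d0 dF]]; first by exists 1.
exists (Num.min (f i) d); first by rewrite lt_min f0.
move=> j; rewrite inE => /predU1P[->|/dF h]; rewrite ge_min ?lexx//.
by rewrite h orbT.
Qed.

Lemma seq_eventually (F : seq I) (Q : I -> nat -> Prop) :
  (forall i, i \in F -> exists N, forall n, (N <= n)%N -> Q i n) ->
  exists N, forall n, (N <= n)%N -> forall i, i \in F -> Q i n.
Proof.
elim: F => [|i F IH] h; first by exists 0%N.
have [N NP] := h i (mem_head _ _).
have [|N' NP'] := IH; first by move=> j jF; apply: h; rewrite inE jF orbT.
exists (maxn N N') => n; rewrite geq_max => /andP[Nn N'n] j.
by rewrite inE => /predU1P[->|jF]; [exact: NP|exact: NP'].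
Qed.

End finite_choices.

Section cylinders.
Context (K : topologicalType) (e : nat -> set K).

Definition cyl (s : seq (nat * bool)) : set K :=
  [set z | all (fun p => `[< e p.1 z >] == p.2) s].

Lemma cylI s s' : cyl s `&` cyl s' = cyl (s ++ s').
Proof.
by apply/seteqP; split=> z; rewrite /cyl/= all_cat => /andP.
Qed.

Lemma cyl_nil : cyl [::] = setT.
Proof. by apply/seteqP; split. Qed.

(** The atom of [y] in the algebra generated by the first [n] of the sets
    [e k]. *)
Definition cyl_nb (y : K) (n : nat) := cyl [seq (k, `[< e k y >]) | k <- iota 0 n].

Lemma cyl_nbP y n z :
  cyl_nb y n z <-> forall k, (k < n)%N -> `[< e k z >] = `[< e k y >].
Proof.
rewrite /cyl_nb /cyl/= all_map; split.
  by move=> /allP h k kn; apply/eqP/(h k); rewrite mem_iota.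
by move=> h; apply/allP => k; rewrite mem_iota/= add0n => kn; apply/eqP/h.
Qed.

Lemma cyl_nb_refl y n : cyl_nb y n y.
Proof. exact/cyl_nbP. Qed.

Lemma cyl_nbS y m n : (m <= n)%N -> cyl_nb y n `<=` cyl_nb y m.
Proof. by move=> mn z /cyl_nbP h; apply/cyl_nbP => k km; apply: h; exact: leq_trans mn. Qed.

Lemma cyl_nb_disjoint y z k n : (k < n)%N -> `[< e k y >] != `[< e k z >] ->
  cyl_nb y n `&` cyl_nb z n = set0.
Proof.
move=> kn yz; rewrite -subset0 => t [/cyl_nbP ty /cyl_nbP tz].
by move: yz; rewrite -ty// -tz// eqxx.
Qed.

Hypothesis e_clopen : forall k, clopen (e k).

Lemma cyl_clopen s : clopen (cyl s).
Proof.
elim: s => [|[k b] s IH]; first by rewrite cyl_nil; exact: clopenT.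
rewrite (_ : cyl _ = (if b then e k else ~` e k) `&` cyl s).
  by apply: clopenI => //; case: b => //; exact: (clopenC (e k)).
apply/seteqP; split=> z; rewrite /cyl/=.
  by move=> /andP[/eqP <- h]; split => //; case: ifPn => /asboolP.
by move=> [+ ->]; case: b => zk; rewrite andbT; apply/eqP/asboolP.
Qed.

End cylinders.

Section restriction.
Context (K : topologicalType) (R : realType).

Lemma cond_clopen_prob (m : set K -> R) W : clopen_prob m -> clopen W ->
  0 < m W -> clopen_prob (fun C => m (C `&` W) / m W).
Proof.
move=> mP cW mW; split=> [C cC|C V cC cV|].
- by rewrite divr_ge0// ?(ltW mW)// (cp_ge0 mP)//; exact: clopenI.
- rewrite -mulrDl (cpID mP (clopenI cC cW) cV); congr ((m _ + m _) / _).
    by rewrite setIAC.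
  by rewrite !setDE setIAC.
- by rewrite setTI divff// gt_eqF.
Qed.

(** The part of [m] on [W] is replaced by the part of [n] on [W], rescaled so
    that the total mass is kept. *)
Lemma graft_clopen_prob (m n : set K -> R) W c : clopen_prob m ->
  clopen_prob n -> clopen W -> 0 <= c -> m W = c * n W ->
  clopen_prob (fun C => m (C `\` W) + c * n (C `&` W)).
Proof.
move=> mP nP cW c0 mn; split=> [C cC|C V cC cV|].
- apply: addr_ge0; first by apply: (cp_ge0 mP); exact: clopenD.
  by apply: mulr_ge0 => //; apply: (cp_ge0 nP); exact: clopenI.
- rewrite (cpID mP (clopenD cC cW) cV) (cpID nP (clopenI cC cW) cV).
  rewrite mulrDr addrACA; congr (_ + c * _ + (_ + c * _)).
  + by congr m; rewrite !setDE setIAC.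
  + by congr n; rewrite setIAC.
  + by congr m; rewrite !setDE setIAC.
  + by congr n; rewrite !setDE setIAC.
- by rewrite setTD setTI (cpC mP)// mn -(cpT mP); lra.
Qed.

End restriction.

(** * The fiber order on measures *)

Section domination.
Context (K : ptopologicalType) (R : realType) (D D' : set (set K)).
Notation P := (radon_prob K R).

(** The fiber preorder of the projection from the quotient by [D'] to the quotient
    by [D], read on representatives (lemma [fiber_le_dom]). *)
Definition fiber_dom (s t : P) := forall (S : seq (set K)) (e : R),
  (forall C, C \in S -> D' C) -> 0 < e ->
  exists (G : seq (set K)) (d : R), [/\ forall C, C \in G -> D' C, 0 < d &
    forall tau, clopen_ball t G d tau ->
      exists2 sg, clopen_ball s S e sg & agree D sg tau].

End domination.

(** * Mixtures *)

Section decomposition.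
Context (K : ptopologicalType) (R : realType).
Hypotheses (K_hausdorff : hausdorff_space K) (K_compact : compact [set: K]).
Hypothesis K_scattered : scattered K.
Notation P := (radon_prob K R).
Context (I : choiceType) (r : I -> R) (x : I -> K) (mu : P).
Hypothesis r_gt0 : forall i, 0 < r i.

Let realize := @clopen_prob_radon K R K_hausdorff K_compact K_scattered.

(** For weights of sum one this says that [nu] is the sum of the [r i *: eta i].
    Bounding the finite partial sums from below is enough: all total masses are
    one, so the bounds for [C] and for its complement add up to an equality
    (compare lemma [mixture_upper]), and no infinite sum has to be manipulated. *)
Definition mixture (nu : P) (eta : I -> P) := forall (F : seq I) C,
  uniq F -> clopen C -> \sum_(i <- F) r i * cval (eta i) C <= cval nu C.

Let dx i : P := dirac_prob R (x i).

Hypothesis mu_mix : mixture mu dx.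
Hypothesis r_sum : forall d : R, 0 < d ->
  exists2 F : seq I, uniq F & 1 - d < \sum_(i <- F) r i.

Lemma sum_r_le1 (F : seq I) : uniq F -> \sum_(i <- F) r i <= 1.
Proof.
move=> uF; have := mu_mix uF clopenT.
rewrite (cpT (cval_prob mu)); apply: le_trans.
by under [X in _ <= X]eq_bigr do rewrite (cpT (cval_prob _)) mulr1.
Qed.

Lemma r_le1 i : r i <= 1.
Proof. by have := @sum_r_le1 [:: i]; rewrite big_seq1; apply. Qed.

Lemma r_sum_mem i (d : R) : 0 < d ->
  exists F : seq I, [/\ uniq F, i \in F & 1 - d < \sum_(j <- F) r j].
Proof.
move=> d0; have [F uF Fd] := r_sum d0.
have [iF|iF] := boolP (i \in F); first by exists F.
exists (i :: F); rewrite /= iF mem_head; split=> //.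
by rewrite big_cons ltr_wpDl// ltW.
Qed.

Lemma mixture_single nu eta i C : mixture nu eta -> clopen C ->
  r i * cval (eta i) C <= cval nu C.
Proof. by move=> m cC; have := m [:: i] C isT cC; rewrite big_seq1. Qed.

Lemma mixture_upper nu eta (F : seq I) C (d : R) : mixture nu eta ->
  uniq F -> clopen C -> 1 - d < \sum_(i <- F) r i ->
  cval nu C <= \sum_(i <- F) r i * cval (eta i) C + d.
Proof.
move=> m uF cC Fd; have := m F (~` C) uF (clopenC C cC).
rewrite (cpC (cval_prob nu) cC).
under eq_bigr do rewrite (cpC (cval_prob _) cC) mulrBr mulr1.
by rewrite sumrB; lra.
Qed.

(** If [eta i] is carried by [W] and [nu W] is close to [r i], then inside [W]
    the measure [nu] is close to [r i *: eta i]. *)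
Lemma mixture_local nu eta i C W : mixture nu eta -> clopen C -> clopen W ->
  cval (eta i) W = 1 ->
  r i * cval (eta i) C <= cval nu (C `&` W) /\
  cval nu (C `&` W) <= r i * cval (eta i) C + (cval nu W - r i).
Proof.
move=> m cC cW W1.
have W0 V : clopen V -> cval (eta i) (V `\` W) = 0.
  move=> cV; have mP := cval_prob (eta i); apply/eqP.
  rewrite eq_le (cp_ge0 mP) ?andbT; last exact: clopenD.
  have := cpS mP (clopenD cV cW) (clopenC W cW) (@subIsetr _ V (~` W)).
  by rewrite (cpC mP)// W1; lra.
have CW : cval (eta i) (C `&` W) = cval (eta i) C.
  by rewrite [RHS](cpID (cval_prob (eta i)) cC cW) W0// addr0.
split; first by rewrite -CW; apply: mixture_single => //; exact: clopenI.
have := mixture_single i m (clopenD cW cC).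
have WC : cval (eta i) (W `\` C) = 1 - cval (eta i) C.
  rewrite -CW -W1 (cpID (cval_prob (eta i)) cW cC) setIC; lra.
rewrite WC mulrBr mulr1.
have := cpID (cval_prob nu) cW cC; rewrite setIC; lra.
Qed.

Context (e : nat -> set K).
Hypothesis e_clopen : forall k, clopen (e k).
Hypothesis e_sep : forall i j, i != j ->
  exists k, `[< e k (x i) >] != `[< e k (x j) >].

Let nb i n := cyl_nb e (x i) n.
Let nb_clopen i n : clopen (nb i n). Proof. exact: cyl_clopen. Qed.

Lemma nb_disjoint (F : seq I) : exists N, forall n, (N <= n)%N ->
  {in F &, forall i j, i != j -> nb i n `&` nb j n = set0}.
Proof.
have [|N NP] := @seq_eventually I F
  (fun i n => forall j, j \in F -> i != j -> nb i n `&` nb j n = set0).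
  move=> i iF.
  have [|N NP] := @seq_eventually I F (fun j n => i != j -> nb i n `&` nb j n = set0).
    move=> j jF; have [->|ij] := eqVneq i j; first by exists 0%N => n _ /negP.
    have [k kij] := e_sep ij; exists k.+1 => n kn _.
    exact: cyl_nb_disjoint kn kij.
  by exists N => n Nn j; exact: NP.
by exists N => n Nn i j iF jF; exact: NP.
Qed.

Lemma mu_nb_ge i n : r i <= cval mu (nb i n).
Proof.
have := mixture_single i mu_mix (nb_clopen i n).
by rewrite cval_dirac mem_set ?mulr1//; exact: cyl_nb_refl.
Qed.

(** Choose finitely many indices that carry almost all the mass and separate [i]
    from the others. *)
Lemma mu_nb i (k : R) : 0 < k ->
  exists N, forall n, (N <= n)%N -> cval mu (nb i n) < r i + k.
Proof.
move=> k0; have [F [uF iF Fk]] := r_sum_mem i (divr_gt0 k0 (ltr0n _ 2)).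
have [N NP] := nb_disjoint F; exists N => n Nn.
have dis := NP n Nn.
have := mixture_upper mu_mix (rem_uniq i uF) (nb_clopen i n) (d := r i + k / 2).
have Fi : \sum_(j <- F) r j = r i + \sum_(j <- rem i F) r j.
  by rewrite (perm_big _ (perm_to_rem iF)) big_cons.
have -> : \sum_(j <- rem i F) r j * cval (dx j) (nb i n) = 0.
  rewrite big_seq big1// => j; rewrite mem_rem_uniq// inE => /andP[ji jF].
  rewrite cval_dirac memNset ?mulr0// => jn.
  have : (nb i n `&` nb j n) (x j) by split => //; exact: cyl_nb_refl.
  by rewrite dis// eq_sym.
rewrite add0r => h; apply: le_lt_trans (h _) _; last by rewrite ltrD2l; lra.
by move: Fk; rewrite Fi; lra.
Qed.

Lemma mixture_exists eta : exists nu, mixture nu eta.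
Proof.
pose a C i := ((r i * cval (eta i) C)%:E : \bar R).
have a_ge0 C i : clopen C -> (0 <= a C i)%E.
  by move=> cC; rewrite lee_fin mulr_ge0 ?(ltW (r_gt0 _))// (cp_ge0 (cval_prob _)).
have fsumE C (F : set I) : finite_set F ->
    (\sum_(i \in F) a C i = (\sum_(i <- fset_set F) r i * cval (eta i) C)%:E)%E.
  by move=> finF; rewrite fsbig_finite//= sumEFin.
have fsum_le C (F : seq I) : clopen C -> uniq F ->
    \sum_(i <- F) r i * cval (eta i) C <= 1.
  move=> cC uF; apply: le_trans (sum_r_le1 uF); apply: ler_sum => i _.
  by rewrite ler_piMr ?(ltW (r_gt0 _))// (cp_le1 (cval_prob _)).
pose m C := fine (\esum_(i in [set: I]) a C i)%E.
have mE C : clopen C -> (m C)%:E = (\esum_(i in [set: I]) a C i)%E.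
  move=> cC; rewrite fineK// ge0_fin_numE; last first.
    by apply: esum_ge0 => i _; exact: a_ge0.
  apply: (@le_lt_trans _ _ 1%E); last exact: ltry.
  apply: ge_ereal_sup => _ [F [finF _] <-].
  by rewrite fsumE// lee_fin fsum_le.
have m_ge C (F : seq I) : clopen C -> uniq F ->
    \sum_(i <- F) r i * cval (eta i) C <= m C.
  move=> cC uF; rewrite -lee_fin mE//; apply: ereal_sup_ubound.
  exists [set` F]; first by split=> //; exact: finite_seq.
  rewrite fsumE; last exact: finite_seq.
  congr (_%:E); apply: perm_big; apply: uniq_perm => //.
  move=> i; rewrite in_fset_set; last exact: finite_seq.
  by apply/idP/idP => [/set_mem|iF] //; exact: mem_set.
have mP : clopen_prob m.
  split=> [C cC|C W cC cW|].
  - by have := m_ge C [::] cC isT; rewrite big_nil.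
  - have cCW := clopenI cC cW; have cCDW := clopenD cC cW.
    apply: EFin_inj; rewrite EFinD !mE// -esumD//.
    + apply: eq_esum => i _; rewrite /a -EFinD -mulrDr.
      by rewrite (cpID (cval_prob _) cC cW).
    + by move=> i _; exact: a_ge0.
    + by move=> i _; exact: a_ge0.
  - apply/eqP; rewrite eq_le; apply/andP; split.
      rewrite -lee_fin (mE _ clopenT); apply: ge_ereal_sup => _ [F [finF _] <-].
      by rewrite fsumE// lee_fin fsum_le//; exact: clopenT.
    apply/ler_addgt0Pr => d d0; have [F uF Fd] := r_sum d0.
    have := m_ge setT F clopenT uF.
    under eq_bigr do rewrite (cpT (cval_prob _)) mulr1.
    lra.
have [nu nuE] := realize mP.
by exists nu => F C uF cC; rewrite nuE//; exact: m_ge.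
Qed.

(** For a member of [D], the lower bounds by finite sums of Dirac masses hold for it
    and for its complement. *)
Lemma mixture_agree D nu eta : D `<=` clopen -> mixture nu eta ->
  (forall i, agree D (dx i) (eta i)) -> agree D mu nu.
Proof.
move=> Dc m De C DC.
have cC := Dc _ DC.
have le_nu V : clopen V -> (forall i, cval (dx i) V = cval (eta i) V) ->
    cval mu V <= cval nu V.
  move=> cV VE; apply/ler_addgt0Pr => d d0; have [F uF Fd] := r_sum d0.
  apply: le_trans (mixture_upper mu_mix uF cV Fd) _; rewrite lerD2r.
  by under eq_bigr do rewrite VE; exact: m.
symmetry; apply: cp_le_eq => //; [exact: cval_prob|exact: cval_prob| |].
  by apply: le_nu => // i; exact: De.
apply: le_nu => [|i]; first exact: (clopenC C).
by rewrite !(cpC (cval_prob _))//; congr (1 - _); exact: De.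
Qed.

(** This closure condition on [D] makes restriction to a cylinder well defined
    modulo agreement on [D].  Unlike closure under all finite intersections, which
    would describe the quotients that come from quotients of [K], it is inherited
    by unions, that is by suprema of quotients. *)
Definition localizable D :=
  [/\ D `<=` @clopen K, forall s, D (cyl e s) & forall C s, D C -> D (C `&` cyl e s)].

(** The component [eta i] is the normalized restriction of [nu] to the intersection
    of the cylinder neighbourhoods of [x i], obtained on clopen sets as a monotone
    limit. *)
Lemma mixture_decompose D nu : localizable D -> agree D mu nu ->
  exists2 eta, mixture nu eta & forall i, agree D (dx i) (eta i).
Proof.
move=> [Dc Dcyl DI] munu.
have nuP := cval_prob nu.
pose a i C n := cval nu (C `&` nb i n).
have a_dec i C : clopen C -> nonincreasing_seq (a i C).
  move=> cC m n mn; apply: (cpS nuP); [exact: clopenI|exact: clopenI|].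
  by apply: setIS; exact: cyl_nbS.
have a_cvg i C : clopen C -> cvgn (a i C).
  move=> cC; apply: nonincreasing_is_cvgn; first exact: a_dec.
  by exists 0 => _ [n _ <-]; apply: (cp_ge0 nuP); exact: clopenI.
have nb_cvg i : (fun n => cval mu (nb i n)) @ \oo --> r i.
  apply/cvgrPdist_lt => d d0; have [N NP] := mu_nb i d0.
  near=> n; have := NP n; have := mu_nb_ge i n.
  have -> : (N <= n)%N by near: n; exact: nbhs_infty_ge.
  by move=> h /(_ isT) h'; rewrite distrC ger0_norm ?subr_ge0//; lra.
pose w i C := limn (a i C) / r i.
have wP i : clopen_prob (w i).
  split=> [C cC|C W cC cW|].
  - apply: divr_ge0; last exact: ltW.
    apply: limr_ge; first exact: a_cvg.
    by apply: nearW => n; apply: (cp_ge0 nuP); exact: clopenI.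
  - rewrite /w -mulrDl; congr (_ / _).
    have c1 := a_cvg i _ (clopenI cC cW); have c2 := a_cvg i _ (clopenD cC cW).
    rewrite -limD//; congr (limn _); apply/funext => n.
    rewrite /a [LHS](cpID nuP (clopenI cC (nb_clopen i n)) cW).
    by congr (cval nu _ + cval nu _); rewrite ?setDE setIAC.
  - rewrite /w (_ : a i setT = fun n => cval mu (nb i n)).
      by rewrite (cvg_lim _ (nb_cvg i)) ?divff// gt_eqF.
    by apply/funext => n; rewrite /a setTI munu//; exact: Dcyl.
have /choice[eta etaE] := fun i => realize (wP i).
exists eta => [F C uF cC|i C DC]; last first.
  have cC := Dc C DC.
  rewrite etaE// /w cval_dirac.
  have aE n : a i C n = cval mu (C `&` nb i n) by rewrite /a munu//; exact: DI.
  have lo : r i * cval (dx i) C <= limn (a i C).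
    apply: limr_ge; first exact: a_cvg.
    apply: nearW => n; rewrite aE.
    apply: (proj1 (mixture_local mu_mix cC (nb_clopen i n) _)).
    by rewrite cval_dirac mem_set//; exact: cyl_nb_refl.
  have up : limn (a i C) <= r i * cval (dx i) C.
    apply/ler_addgt0Pr => d d0; have [N NP] := mu_nb i d0.
    apply: limr_le; first exact: a_cvg.
    near=> n; rewrite aE.
    have := proj2 (mixture_local mu_mix cC (nb_clopen i n) (i := i) _).
    rewrite cval_dirac mem_set; last exact: cyl_nb_refl.
    move=> /(_ erefl); have := NP n.
    have -> : (N <= n)%N by near: n; exact: nbhs_infty_ge.
    by move=> /(_ isT); lra.
  have -> : limn (a i C) = r i * cval (dx i) C by apply/eqP; rewrite eq_le up lo.
  by rewrite cval_dirac mulrAC divff ?mul1r// gt_eqF.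
under eq_bigr do rewrite etaE// /w mulrC divfK ?gt_eqF//.
have cvgF : (fun n => \sum_(i <- F) a i C n) @ \oo --> \sum_(i <- F) limn (a i C).
  by apply: cvg_big => [|i _]; [exact: add_continuous|exact: a_cvg].
rewrite -(cvg_lim _ cvgF)//; apply: limr_le; first by apply: cvgP cvgF.
have [N NP] := nb_disjoint F.
near=> n; apply: (cp_sum_disjoint nuP) => //; apply: NP.
by near: n; exact: nbhs_infty_ge.
Unshelve. all: by end_near. Qed.

Lemma agree_dirac_nb D eta i n : (forall s, D (cyl e s)) ->
  agree D (dx i) (eta i) -> cval (eta i) (nb i n) = 1.
Proof.
by move=> Dcyl dxi; rewrite -(dxi _ (Dcyl _)) cval_dirac mem_set//; exact: cyl_nb_refl.
Qed.

(** Finitely many indices carry almost all the mass.  For [tau] close to [nu'], its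
    normalized restrictions to disjoint cylinders around the corresponding [x i]
    are close to the components [eta' i], hence agree on [D] with measures close to
    [eta i].  Put these back in place of the restrictions of [tau]. *)
Lemma fiber_dom_mixture D D' nu nu' eta eta' :
  localizable D -> localizable D' ->
  mixture nu eta -> mixture nu' eta' -> agree D mu nu' ->
  (forall i, agree D (dx i) (eta' i)) ->
  (forall i, fiber_dom D D' (eta i) (eta' i)) -> fiber_dom D D' nu nu'.
Proof.
move=> [Dc Dcyl DI] [Dc' Dcyl' DI'] m m' munu' dxeta' dm S eps SD' eps0.
(* [d1] is spent three times: on the tail of the mixture, on the masses of the
   cylinders and on the components. *)
pose d1 := eps / 4.
have d10 : 0 < d1 by rewrite /d1; lra.
have [F uF Fd] := r_sum d10.
have /choice[Gd GdP] : forall i, exists Gd : seq (set K) * R,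
    [/\ forall C, C \in Gd.1 -> D' C, 0 < Gd.2 &
    forall tau, clopen_ball (eta' i) Gd.1 Gd.2 tau ->
      exists2 sg, clopen_ball (eta i) S d1 sg & agree D sg tau].
  by move=> i; have [G [d GP]] := dm i S d1 SD' d10; exists (G, d).
pose kf i := r i * Num.min d1 (Num.min (1 / 2) ((Gd i).2 / 8)).
have kf0 i : 0 < kf i.
  apply: mulr_gt0 => //; rewrite !lt_min d10 /=.
  by have [_ + _] := GdP i; move=> ?; apply/andP; split; lra.
have [k k0 kF] := seq_lower_bound F kf0.
have [N1 N1P] := nb_disjoint F.
have [N2 N2P] := @seq_eventually I F (fun i n => cval mu (nb i n) < r i + k)
  (fun i _ => mu_nb i k0).
pose n := maxn N1 N2; pose W i := nb i n.
have cW i : clopen (W i) by exact: nb_clopen.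
have disW := N1P n (leq_maxl _ _); have muW := N2P n (leq_maxr _ _).
have munuW i : cval mu (W i) = cval nu' (W i) by apply: munu'; exact: Dcyl.
exists ([seq W i | i <- F] ++ [seq C `&` W i | i <- F, C <- (Gd i).1]), k.
split=> //.
  move=> C; rewrite mem_cat => /orP[/mapP[i _ ->]|]; first exact: Dcyl'.
  move=> /allpairsPdep[i [C' [iF C'G ->]]]; apply: DI'.
  by have [h _ _] := GdP i; exact: h.
move=> tau tauG.
have tP := cval_prob tau.
have tW i : i \in F -> `|cval tau (W i) - cval mu (W i)| < k.
  move=> iF; rewrite munuW; apply: tauG; rewrite mem_cat; apply/orP; left.
  exact: map_f.
have kF' i : i \in F -> [/\ k <= r i * d1, k <= r i / 2 & k <= r i * (Gd i).2 / 8].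
  move=> iF; have := kF i iF; have := r_gt0 i => ri0 kfi.
  split; apply: le_trans kfi _.
  - by rewrite ler_pM2l// ge_min lexx.
  - by rewrite ler_pM2l// !ge_min mul1r lexx orbT.
  - by rewrite -mulrA ler_pM2l// !ge_min lexx !orbT.
have tW0 i : i \in F -> 0 < cval tau (W i).
  move=> iF; have := tW i iF; have [_ k2 _] := kF' i iF; have := mu_nb_ge i n.
  by have := r_gt0 i; rewrite ltr_distl => ? ? /andP[]; rewrite -/(W i); lra.
(* The replacement of the normalized restriction of [tau] to [W i]. *)
have /choice[sg sgP] : forall i, exists sg, i \in F ->
    clopen_ball (eta i) S d1 sg /\ forall C, D C ->
    cval tau (W i) * cval sg C = cval tau (C `&` W i).
  move=> i; have [iF|] := boolP (i \in F); last by exists tau.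
  have [taui tauiE] := realize (cond_clopen_prob tP (cW i) (tW0 i iF)).
  have [GD' Gd0 GP] := GdP i.
  have [|sg sgS sgD] := GP taui.
    move=> C CG; have cC := Dc' _ (GD' _ CG); rewrite tauiE//.
    have [lo up] := mixture_local m' cC (cW i) (agree_dirac_nb n Dcyl (dxeta' i)).
    have h : `|cval tau (C `&` W i) - cval nu' (C `&` W i)| < k.
      apply: tauG; rewrite mem_cat; apply/orP; right.
      by apply/allpairsPdep; exists i, C.
    have := tW i iF; have := tW0 i iF; have := muW i iF; have := mu_nb_ge i n.
    have [_ k2 k3] := kF' i iF; have := r_gt0 i.
    have := cp_ge0 (cval_prob (eta' i)) cC; have := cp_le1 (cval_prob (eta' i)) cC.
    move: h lo up; rewrite -munuW -/(W i).
    move: (cval tau (C `&` W i)) (cval nu' (C `&` W i)) (cval (eta' i) C).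
    move: (cval tau (W i)) (cval mu (W i)) => t w a b h.
    move=> ab lo up h1 h0 ri0 rw wr t0 tw.
    rewrite -[h](mulfK (lt0r_neq0 t0)) -mulrBl normrM (gtr0_norm (x := t^-1)) ?invr_gt0//.
    rewrite ltr_pdivrMr//.
    move: ab tw; rewrite !ltr_distl => /andP[ab1 ab2] /andP[tw1 tw2].
    have ht1 : h * r i - k <= h * t by nra.
    have ht2 : h * t <= h * r i + 2 * k by nra.
    have dt : 4 * k <= (Gd i).2 * t by nra.
    by apply/andP; split; lra.
  exists sg => _; split=> // C DC.
  by rewrite (sgD C DC) (tauiE C (Dc C DC)) mulrC divfK// gt_eqF// tW0.
(* The replacements, weighted by the masses of [tau], plus the rest of [tau]. *)
pose sm C := \sum_(i <- F) cval tau (W i) * cval (sg i) C +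
  (cval tau C - \sum_(i <- F) cval tau (C `&` W i)).
have sum_ge0 C : clopen C -> 0 <= cval tau C - \sum_(i <- F) cval tau (C `&` W i).
  by move=> cC; rewrite subr_ge0; exact: cp_sum_disjoint.
have smP : clopen_prob sm.
  split=> [C cC|C V cC cV|].
  - apply: addr_ge0; last exact: sum_ge0.
    by apply: sumr_ge0 => i _; rewrite mulr_ge0// ?(cp_ge0 tP)// (cp_ge0 (cval_prob _)).
  - rewrite /sm (cpID tP cC cV).
    have E1 : \sum_(i <- F) cval tau (W i) * cval (sg i) C =
        \sum_(i <- F) cval tau (W i) * cval (sg i) (C `&` V) +
        \sum_(i <- F) cval tau (W i) * cval (sg i) (C `\` V).
      rewrite -big_split; apply: eq_bigr => i _.
      by rewrite (cpID (cval_prob (sg i)) cC cV) mulrDr.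
    have E2 : \sum_(i <- F) cval tau (C `&` W i) =
        \sum_(i <- F) cval tau ((C `&` V) `&` W i) +
        \sum_(i <- F) cval tau ((C `\` V) `&` W i).
      rewrite -big_split; apply: eq_bigr => i _.
      rewrite (cpID tP (clopenI cC (cW i)) cV) setIAC; congr (_ + cval tau _).
      by rewrite !setDE setIAC.
    by rewrite E1 E2; lra.
  - rewrite /sm (cpT tP).
    under eq_bigr do rewrite (cpT (cval_prob _)) mulr1.
    under [X in _ - X]eq_bigr do rewrite setTI.
    by lra.
have [sig sigE] := realize smP.
exists sig; last first.
  move=> C DC; rewrite (sigE C (Dc C DC)) /sm.
  rewrite (eq_big_seq (fun i => cval tau (C `&` W i))); first by lra.
  by move=> i iF; have [_ h] := sgP i iF; exact: h.
have lower V : clopen V ->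
    (forall i, i \in F -> cval (eta i) V - d1 < cval (sg i) V) ->
    cval nu V - eps < cval sig V.
  move=> cC h; rewrite sigE// /sm.
  have h1 := mixture_upper m uF cC Fd; have h2 := sum_ge0 V cC.
  have h3 : d1 * \sum_(i <- F) r i <= d1 by rewrite ler_piMr ?sum_r_le1// ltW.
  suff : \sum_(i <- F) r i * cval (eta i) V - (2 * d1) * \sum_(i <- F) r i <=
      \sum_(i <- F) cval tau (W i) * cval (sg i) V.
    have : d1 = eps / 4 by []. lra.
  rewrite mulr_sumr -sumrB; rewrite [X in X <= _]big_seq [X in _ <= X]big_seq.
  apply: ler_sum => i iF; have := h i iF.
  have := tW i iF; have [k1 _ _] := kF' i iF; have := mu_nb_ge i n.
  have := cp_ge0 (cval_prob (sg i)) cC; have := cp_le1 (cval_prob (sg i)) cC.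
  rewrite -/(W i) ltr_distl.
  move: (cval (sg i) V) (cval (eta i) V) (cval tau (W i)) (cval mu (W i)).
  move=> s a t w s1 s0 rw /andP[tw1 tw2] as_; have := r_gt0 i => ri0.
  have : r i * (1 - d1) <= t by lra.
  have : r i * (a - d1) <= r i * s by nra.
  have : r i * d1 * s <= r i * d1 by nra.
  by nra.
move=> C CS; have cC := Dc' _ (SD' _ CS).
apply: cp_near; [exact: cval_prob|exact: cval_prob|exact: cC|apply: lower|apply: lower].
- exact: cC.
- by move=> i iF; have [/(_ C CS) + _] := sgP i iF; rewrite ltr_distl => /andP[].
- exact: (clopenC C).
- move=> i iF; have [/(_ C CS) + _] := sgP i iF; rewrite ltr_distl => /andP[_].
  by rewrite !(cpC (cval_prob _))//; lra.
Qed.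

(** Given [tau] close to [eta' i], graft it onto [nu'] inside a small cylinder [V]
    around [x i].  All the mass of the grafted measure in [V] is then proportional
    to [tau], although other components of [nu'] may live in [V]: they are
    overwritten, at a small cost since [mu V] is close to [r i].  The grafted
    measure is close to [nu'], hence agrees on [D] with some [sg] close to [nu],
    and the part of [sg] in [V], grafted back onto [tau], is close to [eta i]. *)
Lemma fiber_dom_component D D' nu nu' eta eta' i :
  localizable D -> localizable D' ->
  mixture nu eta -> mixture nu' eta' -> agree D mu nu -> agree D mu nu' ->
  agree D (dx i) (eta i) -> agree D (dx i) (eta' i) ->
  fiber_dom D D' nu nu' -> fiber_dom D D' (eta i) (eta' i).
Proof.
move=> [Dc Dcyl DI] [Dc' Dcyl' DI'] m m' munu munu' dxeta dxeta' dm S eps SD' eps0.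
have ri0 := r_gt0 i; have ri1 := r_le1 i.
pose k := r i * eps / 8.
have k0 : 0 < k by rewrite divr_gt0// mulr_gt0.
have [N /(_ _ (leqnn N)) muW] := mu_nb i k0.
pose W := nb i N; have cW : clopen W by exact: nb_clopen.
have WE (s : P) : agree D mu s -> cval s W = cval mu W.
  by move=> mus; rewrite -mus//; exact: Dcyl.
have [|G [d [GD' d0 GP]]] := dm [seq C `&` W | C <- S] k _ k0.
  by move=> _ /mapP[C CS ->]; apply: DI'; exact: SD'.
(* The cylinder [W] has to be chosen before [d], which depends on it; the graft
   is made in a smaller cylinder [V], chosen after [d]. *)
pose p := Num.min (k / 4) (Num.min (d / 4) (1 / 2)).
have p0 : 0 < p by rewrite !lt_min; apply/and3P; split; lra.
have [pk pd p2] : [/\ p <= k / 4, p <= d / 4 & p <= 1 / 2].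
  by split; rewrite !ge_min lexx ?orbT.
have [N' N'P] := mu_nb i p0.
pose n := maxn N N'; pose V := nb i n.
have muV : cval mu V < r i + p by apply: N'P; exact: leq_maxr.
have muV_ge : r i <= cval mu V by exact: mu_nb_ge.
have cV : clopen V by exact: nb_clopen.
have VW : V `<=` W by apply: cyl_nbS; exact: leq_maxl.
have DV : D V by exact: Dcyl.
have DW : D W by exact: Dcyl.
have V1 : cval (eta' i) V = 1 by exact: agree_dirac_nb Dcyl dxeta'.
have W1 : cval (eta i) W = 1 by exact: agree_dirac_nb Dcyl dxeta.
exists (V :: G), p; split => //.
  by move=> C; rewrite inE => /predU1P[->|/GD'//]; exact: Dcyl'.
move=> tau tauG.
have tP := cval_prob tau; have nP := cval_prob nu'.
have tV : 1 - p < cval tau V.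
  by have := tauG V (mem_head _ _); rewrite V1 ltr_distl => /andP[].
have tV1 := cp_le1 tP cV.
have tV0 : 0 < cval tau V by lra.
pose c := cval mu V / cval tau V.
have ctV : c * cval tau V = cval mu V by rewrite divfK// gt_eqF.
have muV1 := cp_le1 (cval_prob mu) cV.
have c_ge : r i <= c by nra.
have c0 : 0 < c by lra.
have c_lt : c < r i + k by nra.
have nuV : cval nu' V = c * cval tau V by rewrite ctV -munu'.
have [th thE] := realize (graft_clopen_prob nP tP cV (ltW c0) nuV).
have th_near : clopen_ball nu' G d th.
  have lower C : clopen C -> cval (eta' i) C - p < cval tau C ->
      cval nu' C - d < cval th C.
    move=> cC tC; rewrite thE// (cpID nP cC cV).
    have [_ up] := mixture_local m' cC cV V1.
    have tCV := cpID tP cC cV.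
    have tCDV : cval tau (C `\` V) <= 1 - cval tau V.
      rewrite -(cpC tP)//; apply: (cpS tP); first exact: clopenD.
        exact: (clopenC V).
      exact: subIsetr.
    have h : r i * cval tau (C `&` V) <= c * cval tau (C `&` V).
      by apply: ler_wpM2r => //; apply: (cp_ge0 tP); exact: clopenI.
    have h' : r i * (cval (eta' i) C - 2 * p) <= r i * cval tau (C `&` V).
      by rewrite ler_pM2l//; lra.
    have : r i * p <= p by rewrite ler_piMl// ltW.
    move: up; rewrite -(munu' V DV); lra.
  move=> C CG; have cC := Dc' _ (GD' _ CG).
  have := tauG C; rewrite inE CG orbT => /(_ isT); rewrite ltr_distl => /andP[t1 t2].
  apply: cp_near; [exact: cval_prob|exact: nP|exact: cC|exact: lower|].
  apply: lower; first exact: (clopenC C).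
  by rewrite !(cpC (cval_prob _))//; lra.
have [sg sgS sgD] := GP th th_near.
have sP := cval_prob sg.
have sV : cval sg V = c * cval tau V.
  by rewrite sgD// thE// setDv (cp0 nP) setIid add0r.
have sW : cval sg W = cval mu W.
  rewrite sgD// thE// (setIidr VW) ctV (cpB nP)// -!munu'//; lra.
have tsV : cval tau V = c^-1 * cval sg V by rewrite sV mulKf// gt_eqF.
have cV0 : 0 <= c^-1 by rewrite invr_ge0 ltW.
have [si siE] := realize (graft_clopen_prob tP sP cV cV0 tsV).
exists si; last first.
  move=> C DC; have cC := Dc C DC; have DCV : D (C `&` V) by exact: DI.
  rewrite (siE C cC) (sgD _ DCV) (thE _ (clopenI cC cV)).
  rewrite (_ : (C `&` V) `\` V = set0); last by rewrite -setIDA setDv setI0.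
  rewrite (cp0 nP) -setIA setIid add0r mulKf ?gt_eqF// addrC.
  by rewrite [RHS](cpID tP cC cV).
have lower C : clopen C -> cval nu (C `&` W) - k < cval sg (C `&` W) ->
    cval (eta i) C - eps < cval si C.
  move=> cC sC; rewrite siE//.
  have [lo _] := mixture_local m cC cW W1.
  have tC0 : 0 <= cval tau (C `\` V) by apply: (cp_ge0 tP); exact: clopenD.
  have sCV : cval sg (C `&` W) - (cval mu W - cval mu V) <= cval sg (C `&` V).
    rewrite (cpID sP (clopenI cC cW) cV) -setIA (setIidr VW).
    have : cval sg ((C `&` W) `\` V) <= cval sg (W `\` V).
      apply: (cpS sP); first exact: clopenD (clopenI cC cW) cV.
        exact: clopenD.
      by apply: setSD; exact: subIsetr.
    rewrite (cpB sP cW cV VW) sW sV ctV; lra.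
  have e1 := cp_le1 (cval_prob (eta i)) cC.
  have e0 := cp_ge0 (cval_prob (eta i)) cC.
  suff : cval (eta i) C - eps < c^-1 * cval sg (C `&` V) by lra.
  rewrite mulrC ltr_pdivlMr//.
  have h1 : c * cval (eta i) C <= r i * cval (eta i) C + k by nra.
  have h2 : r i * eps <= c * eps by rewrite ler_pM2r.
  have : r i * eps = 8 * k by rewrite /k; lra.
  rewrite mulrC; lra.
move=> C CS; have cC := Dc' _ (SD' _ CS).
have CWS : C `&` W \in [seq C' `&` W | C' <- S] by apply/mapP; exists C.
have := sgS _ CWS; rewrite ltr_distl => /andP[s1 s2].
apply: cp_near; [exact: cval_prob|exact: cval_prob|exact: cC|exact: lower|].
apply: lower; first exact: (clopenC C).
have := cpID sP cW cC; have := cpID (cval_prob nu) cW cC.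
rewrite sW (WE nu munu) setDE (setIC W C) (setIC W (~` C)); lra.
Qed.

End decomposition.

(** * The isomorphism *)

(** A relation avoids choosing normal forms: a decomposition of a measure is only
    determined modulo agreement on the larger family. *)
Lemma order_isomorphic_rel d d' (A : porderType d) (B : porderType d')
    (rho : A -> B -> Prop) :
  (forall a, exists b, rho a b) -> (forall b, exists a, rho a b) ->
  (forall a a' b b', rho a b -> rho a' b' -> (a <= a')%O = (b <= b')%O) ->
  order_isomorphic A B.
Proof.
move=> /choice[h hP] /choice[g gP] rhoE; exists h.
  exists g => [a|b]; apply: le_anti.
    by rewrite !(rhoE _ _ _ _ (gP (h a)) (hP a)) !(rhoE _ _ _ _ (hP a) (gP (h a))) !lexx.
  by rewrite -(rhoE _ _ _ _ (hP (g b)) (gP b)) -(rhoE _ _ _ _ (gP b) (hP (g b))) !lexx.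
by move=> a a'; rewrite (rhoE _ _ _ _ (hP a) (hP a')).
Qed.

Section fibers.
Local Open Scope quotient_scope.
Context (X : topologicalType) (L L' : equiv_rel X) (q : quot L' -> quot L).
Hypothesis q_nat : natural_projection q.
Variable y : quot L.

Definition represents (a : fiber_order q y) (s : X) :=
  exists z : fiber q y, a = \pi_(fiber_order q y) z /\ val z = quot_proj L' s.

Lemma represents_ex a : exists s, represents a s.
Proof.
exists (repr (val (repr a))), (repr a); rewrite reprK; split => //.
by rewrite /quot_proj reprK.
Qed.

Lemma represents_fiber a s : represents a s -> quot_proj L s = y.
Proof.
have [_ _ qE] := q_nat.
move=> [z [_ zs]]; rewrite -qE -zs; exact: set_mem (valP z).
Qed.

Lemma fiber_represents s : quot_proj L s = y -> exists a, represents a s.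
Proof.
have [_ _ qE] := q_nat => sy.
have sq : quot_proj L' s \in q @^-1` [set y] by apply: mem_set; rewrite /= qE.
pose z : fiber q y := exist _ (quot_proj L' s) sq.
by exists (\pi_(fiber_order q y) z), z.
Qed.

Lemma represents_le a a' s s' : represents a s -> represents a' s' ->
  (a <= a')%O <-> fiber_le q (quot_proj L' s) (quot_proj L' s').
Proof.
move=> [z [-> <-]] [z' [-> <-]]; exact: fiber_order_le_pi.
Qed.

End fibers.

Section purely_atomic.
Context (R : realType) (K : ptopologicalType).
Hypotheses (K_hausdorff : hausdorff_space K) (K_compact : compact [set: K]).
Hypothesis K_scattered : scattered K.
Notation P := (radon_prob K R).

(** Both sides speak of balls given by finitely many members of [D'], through the
    description of the neighbourhoods in the quotient. *)
Lemma fiber_le_dom (D D' : set (set K)) (L L' : equiv_rel P)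
    (q : quot L' -> quot L) s t :
  D' `<=` @clopen K ->
  (forall s t, L s t <-> agree D s t) -> (forall s t, L' s t <-> agree D' s t) ->
  natural_projection q ->
  fiber_le q (quot_proj L' s) (quot_proj L' t) <-> fiber_dom D D' s t.
Proof.
move=> Dc' LD LD' [_ _ qE]; split=> [st S eps SD' eps0|st U].
  have /st[V tV qVU] : nbhs (quot_proj L' s) (quot_proj L' @` clopen_ball s S eps).
    apply: (quot_nbhs_ball LD' Dc' SD' eps0).
    by move=> u su; exists u.
  have [G [d [GD' d0 GV]]] :=
    quot_nbhs K_hausdorff K_compact K_scattered LD' Dc' tV.
  exists G, d; split => // tau /GV Vtau.
  have [|_ [sg sgS <-]] := qVU (quot_proj L tau); first by exists (quot_proj L' tau).
  by rewrite qE => /quot_projE/LD; exists sg.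
move=> /(quot_nbhs K_hausdorff K_compact K_scattered LD' Dc')[S [eps [SD' eps0 SU]]].
have [G [d [GD' d0 GP]]] := st S eps SD' eps0.
exists (quot_proj L' @` clopen_ball t G d).
  apply: (quot_nbhs_ball LD' Dc' GD' d0).
  by move=> u tu; exists u.
move=> _ [_ [tau tG <-] <-]; have [sg sgS sgtau] := GP tau tG.
exists (quot_proj L' sg); first exact: SU.
by rewrite !qE; apply/quot_projE/LD.
Qed.

Context (I : choiceType) (r : I -> R) (x : I -> K) (mu : P).
Hypothesis x_inj : injective x.
Hypothesis r_gt0 : forall i, 0 < r i.
Hypothesis muE : forall A : set (borel K), measurable A ->
  mu A = (\esum_(i in [set: I]) ((r i)%:E * dirac_prob R (x i) A))%E.

Let dx i : P := dirac_prob R (x i).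

Let mu_fsum C (F : set I) : finite_set F -> clopen C ->
  (\sum_(i \in F) ((r i)%:E * dirac_prob R (x i) C) =
   (\sum_(i <- fset_set F) r i * cval (dx i) C)%:E)%E.
Proof.
move=> finF cC; rewrite fsbig_finite//= -sumEFin; apply: eq_bigr => i _.
by rewrite EFinM cvalE.
Qed.

Lemma dirac_mixture : mixture r mu dx.
Proof.
move=> F C uF cC; rewrite -lee_fin cvalE// muE; last exact: clopen_measurable.
apply: ereal_sup_ubound; exists [set` F]; first by split=> //; exact: finite_seq.
rewrite mu_fsum//.
congr (_%:E); apply: perm_big; apply: uniq_perm => //.
move=> i; rewrite in_fset_set; last exact: finite_seq.
by apply/idP/idP => [/set_mem|iF] //; exact: mem_set.
Qed.

Lemma dirac_mixture_total (d : R) : 0 < d ->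
  exists2 F : seq I, uniq F & 1 - d < \sum_(i <- F) r i.
Proof.
move=> d0.
have : ((1 - d)%:E < mu setT)%E by rewrite probability_setT lte_fin; lra.
rewrite muE; last exact: measurableT.
move=> /ereal_sup_gt[_ [F [finF _] <-]]; rewrite mu_fsum//; last exact: clopenT.
rewrite lte_fin => h; exists (fset_set F); first exact: fset_uniq.
move: h; under eq_bigr do rewrite (cpT (cval_prob _)) mulr1.
by [].
Qed.

Let sum_le1 (F : seq I) : uniq F -> \sum_(i <- F) r i <= 1.
Proof. exact: sum_r_le1 dirac_mixture _. Qed.

(** At most [n] weights exceed [1 / n]. *)
Lemma weights_countable : countable [set: I].
Proof.
pose J (n : nat) := [set i | n.+1%:R^-1 < r i].
suff finJ n : finite_set (J n).
  rewrite (_ : setT = \bigcup_n J n).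
    by apply: bigcup_countable => // n _; exact: finite_set_countable.
  apply/seteqP; split => // i _; have [n nP] := ltr_add_invr (r_gt0 i).
  by exists n => //; rewrite /J/= -[X in X < _]add0r.
apply: contrapT => infJ.
have [F FJ Fn] := infinite_set_fset n.+1 infJ.
have := sum_le1 (fset_uniq F); rewrite leNgt => /negP; apply.
apply: (@le_lt_trans _ _ (\sum_(i <- F) (n.+1%:R^-1 : R))).
  rewrite big_const_seq count_predT iter_addr_0 -[_ *+ size F]mulr_natl.
  by rewrite ler_pdivlMr ?ltr0n// mul1r ler_nat.
have [i iF] : exists i, i \in (F : seq I).
  by move: Fn; case: (enum_fset F) => // i s _; exists i; rewrite mem_head.
rewrite [X in X < _]big_seq [X in _ < X]big_seq; apply: ltr_sum; last by move=> j /FJ.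
by apply/hasP; exists i => //; rewrite mem_index_enum.
Qed.

(** There are countably many pairs of indices. *)
Lemma separating_clopens : exists e : nat -> set K,
  (forall k, clopen (e k)) /\
  forall i j, i != j -> exists k, `[< e k (x i) >] != `[< e k (x j) >].
Proof.
have /countable_injP[f finj] : countable [set: I * I].
  by rewrite -setXTT; apply: countableX; exact: weights_countable.
have K_zero := scattered_zero_dimensional K_hausdorff K_compact K_scattered.
have /choice[e eP] : forall n, exists U : set K, clopen U /\
    forall i j, i != j -> f (i, j) = n -> U (x i) /\ ~ U (x j).
  move=> n; have [[[i j] /= [ij fij]]|nij] :=
      pselect (exists p : I * I, p.1 != p.2 /\ f p = n).
    have [|U [cU Ui Uj]] := K_zero (x i) (x j).
      by apply: contra_neq ij; exact: x_inj.
    exists U; split => // i' j' _ fij'.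
    have [-> ->] : (i', j') = (i, j).
      by apply: finj; [exact: mem_set|exact: mem_set|rewrite fij' fij].
    by [].
  by exists setT; split; [exact: clopenT|move=> i j ij fij; exfalso; apply: nij; exists (i, j)].
exists e; split=> [k|i j ij]; first exact: (eP k).1.
exists (f (i, j)); have [Ui Uj] := (eP (f (i, j))).2 i j ij erefl.
by apply/eqP => h; apply: Uj; apply/asboolP; rewrite -h; apply/asboolP.
Qed.

End purely_atomic.

Theorem theorem1p3 (R : realType) (K : ptopologicalType)
    (K_hausdorff : hausdorff_space K) (K_compact : compact [set: K])
    (K_scattered : scattered K) (K_weight : ~ @second_countable K)
    (I : choiceType) (r : I -> R) (x : I -> K)
    (x_inj : injective x) (r_gt0 : forall i, 0 < r i)
    (mu : radon_prob K R)
    (muE : forall A : set (borel K), measurable A ->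
      mu A = (\esum_(i in [set: I]) ((r i)%:E * dirac_prob R (x i) A))%E) :
  exists S : set (equiv_rel (radon_prob K R)),
    [/\ S `<=` @Qomega (radon_prob K R), cofinal S, sigma_semilattice S &
      forall L L', S L -> S L' -> quot_lt L L' ->
      forall q : quot L' -> quot L, natural_projection q ->
      order_isomorphic
        (fiber_order q (quot_proj L mu))
        (prod_order (fun i => fiber_order q (quot_proj L (dirac_prob R (x i)))))].
Proof.
pose P := radon_prob K R.
pose dx i : P := dirac_prob R (x i).
have [e [e_clopen e_sep]] :=
  separating_clopens K_hausdorff K_compact K_scattered x_inj r_gt0 muE.
(* No cylinder is demanded of the empty family, so that [good] is stable under
   all countable unions, including the empty one. *)
pose good (D : set (set K)) := [/\ countable D, D `<=` @clopen K &
  forall C s, D C -> D (C `&` cyl e s) /\ D (cyl e s)].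
pose S := [set L : equiv_rel P | exists2 D, good D & forall s t, L s t <-> agree D s t].
exists S; split.
- move=> L [D [cD Dc _] LD].
  exact: (agree_Qomega K_hausdorff K_compact K_scattered LD Dc cD).
- move=> L /(Qomega_agree K_hausdorff K_compact K_scattered)[D0 [cD0 D0c D0L]].
  pose D := [set C `&` cyl e s | C in setT |` D0 & s in [set: seq (nat * bool)]].
  exists (agree_rel R D).
    exists D; last exact: agree_relE.
    split.
    + rewrite /D image2E; apply: sub_countable (card_image_le _ _) _.
      apply: countableX; last exact: countableP.
      by rewrite -bigcup2E; apply: bigcup_countable => // -[|[|n]] _ //=; exact: countable1.
    + move=> _ [C C0 [s _ <-]]; apply: clopenI; last exact: cyl_clopen.
      by case: C0 => [->|/D0c//]; exact: clopenT.
    + move=> _ s' [C C0 [s _ <-]]; split.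
        by rewrite -setIA cylI; exists C => //; exists (s ++ s').
      by exists setT; [left|exists s' => //; rewrite setTI].
  apply/quot_leP => s t /agree_relE st; apply: D0L => C D0C; apply: st.
  by exists C; [right|exists [::] => //; rewrite cyl_nil setIT].
- move=> A AS cA.
  have /choice[Ds DsP] : forall L, exists D, A L ->
      good D /\ forall s t, L s t <-> agree D s t.
    move=> L; have [AL|nAL] := pselect (A L); last by exists set0.
    by have [D] := AS L AL; exists D.
  pose D := \bigcup_(L in A) Ds L.
  have gD : good D.
    split.
    + by apply: bigcup_countable => // L /DsP[[]].
    + by move=> C [L /DsP[[_ + _] _]]; apply.
    + move=> C s [L AL DC]; have [[_ _ h] _] := DsP L AL.
      by have [? ?] := h C s DC; split; exists L.
  exists (agree_rel R D); first by exists D => //; exact: agree_relE.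
  split.
  + have [cD Dc _] := gD.
    exact: (agree_Qomega K_hausdorff K_compact K_scattered (@agree_relE _ _ D) Dc cD).
  + move=> L AL; apply/quot_leP => s t /agree_relE st.
    by apply/(proj2 (DsP L AL) s t) => C DC; apply: st; exists L.
  + move=> M' _ ub; apply/quot_leP => s t M'st; apply/agree_relE => C [L AL].
    by apply: (proj1 (proj2 (DsP L AL) s t)); have /quot_leP := ub L AL; apply.
move=> L L' [D [_ Dc DI] LD] [D' [_ Dc' DI'] LD'] [_ nL'L] q qn.
have [[C0 DC0]|D0] := pselect (D !=set0); last first.
  (* [L] is the one-point quotient, over which any two points of [L'] are
     equivalent in the fiber preorder. *)
  have Lall s t : L s t by apply/LD => C DC; exfalso; apply: D0; exists C.
  have leall y (a a' : fiber_order q y) : (a <= a')%O.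
    have [s sa] := represents_ex a; have [s' sa'] := represents_ex a'.
    apply/(represents_le sa sa') => U sU; exists setT; first exact: filterT.
    have [_ _ qE] := qn.
    move=> _ [z _ <-]; exists (quot_proj L' s); first exact: nbhs_singleton.
    have [u <-] := quot_surj z.
    by rewrite !qE; apply/quot_projE.
  apply: (@order_isomorphic_rel _ _ _ _ (fun _ _ => True)).
  + by move=> _; exists (fun i =>
      projT1 (cid (fiber_represents qn (erefl (quot_proj L (dx i)))))).
  + by move=> _; have [b _] := fiber_represents qn (erefl (quot_proj L mu)); exists b.
  + move=> a a' b b' _ _; rewrite leall; symmetry; apply/asboolP => i; exact: leall.
have [[C0' DC0']|D'0] := pselect (D' !=set0); last first.
  exfalso; apply: nL'L; apply/quot_leP => s t _; apply/LD' => C DC.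
  by exfalso; apply: D'0; exists C.
have locD : localizable e D.
  by split => // [s|C s DC]; [have [] := DI C0 s DC0|have [] := DI C s DC].
have locD' : localizable e D'.
  by split => // [s|C s DC]; [have [] := DI' C0' s DC0'|have [] := DI' C s DC].
have Lq s t : quot_proj L s = quot_proj L t <-> agree D t s.
  by split=> [/esym/quot_projE/LD|h]; last exact/esym/quot_projE/LD.
pose rho (a : fiber_order q (quot_proj L mu))
    (b : prod_order (fun i => fiber_order q (quot_proj L (dx i)))) :=
  exists nu eta, [/\ mixture r nu eta, represents a nu &
    forall i, represents (b i) (eta i)].
have mix := dirac_mixture muE; have tot := dirac_mixture_total muE.
apply: (@order_isomorphic_rel _ _ _ _ rho).
- move=> a; have [nu anu] := represents_ex a.
  have /Lq munu := represents_fiber qn anu.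
  have [eta m dxeta] := mixture_decompose K_hausdorff K_compact K_scattered
    r_gt0 mix tot e_clopen e_sep locD munu.
  have bP i : exists b : fiber_order q (quot_proj L (dx i)), represents b (eta i).
    by apply: fiber_represents => //; apply/Lq; exact: dxeta.
  exists (fun i => projT1 (cid (bP i))), nu, eta; split => // i.
  exact: (projT2 (cid (bP i))).
- move=> b; have /choice[eta bP] : forall i, exists s, represents (b i) s.
    by move=> i; exact: represents_ex.
  have dxeta i : agree D (dx i) (eta i) by apply/Lq; exact: (represents_fiber qn (bP i)).
  have [nu m] := mixture_exists K_hausdorff K_compact K_scattered r_gt0 mix tot eta.
  have [a anu] : exists a : fiber_order q (quot_proj L mu), represents a nu.
    by apply: fiber_represents => //; apply/Lq; exact: (mixture_agree mix tot Dc m dxeta).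
  by exists a, nu, eta.
move=> a a' b b' [nu [eta [m anu beta]]] [nu' [eta' [m' anu' beta']]].
have /Lq munu := represents_fiber qn anu.
have /Lq munu' := represents_fiber qn anu'.
have dxeta i : agree D (dx i) (eta i) by apply/Lq; exact: (represents_fiber qn (beta i)).
have dxeta' i : agree D (dx i) (eta' i) by apply/Lq; exact: (represents_fiber qn (beta' i)).
have fiberE s t := fiber_le_dom K_hausdorff K_compact K_scattered s t Dc' LD LD' qn.
apply/idP/idP.
  move=> /(represents_le anu anu')/fiberE nn'; apply/asboolP => i.
  apply/(represents_le (beta i) (beta' i))/fiberE.
  exact: (fiber_dom_component K_hausdorff K_compact K_scattered r_gt0 mix tot e_clopen e_sep
    locD locD' m m' munu munu' (dxeta i) (dxeta' i) nn').
move=> /asboolP bb'; apply/(represents_le anu anu')/fiberE.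
apply: (fiber_dom_mixture K_hausdorff K_compact K_scattered r_gt0 mix tot e_clopen e_sep
  locD locD' m m' munu' dxeta') => i.
by apply/fiberE/(represents_le (beta i) (beta' i)); exact: bb'.
Qed.
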